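(* Let $A,b,\sigma$ satisfy the coefficient assumptions, $f,\Phi,\Psi$ the data assumptions, and $\{P_{t,s}\}$ the smoothing assumption (with constants $C_1>0$, $\gamma\in(0,1)$) of the context. For any $\varepsilon>0$ and $t\in[0,T)$, the mild solution $u_\varepsilon\in\mathcal C_m([0,T]\times H)$ of the penalized equation satisfies, with $\Pi_\varepsilon:=\frac1\varepsilon(u_\varepsilon-\Phi)^+$: (i) $u_\varepsilon(t,\cdot)$ is continuously Fréchet differentiable on $H$ and, for all $x\in H$, $$\|\nabla u_\varepsilon(t,x)\|_H\le C_1\Big[\|\Psi\|_{\mathcal B_m}(T-t)^{-\gamma}+\big(\|f\|_{\mathcal B_{m,T}}+\|\Pi_\varepsilon\|_{\mathcal B_{m,T}}\big)\frac{(T-t)^{1-\gamma}}{1-\gamma}\Big]w_m(x).$$ (ii) For any $R>0$ and any $\beta\in(0,1)$ with $\gamma(1+\beta)<1$, setting $C_R:=C_3(1+R^m)$ with $C_3:=2^{1-\beta}C_1$, for all $x,y\in B_R:=\{z\in H:\|z\|_H\le R\}$, $$\|\nabla u_\varepsilon(t,x)-\nabla u_\varepsilon(t,y)\|_H\le C_R\Big[\|\Psi\|_{\mathcal B_m}(T-t)^{-\gamma(1+\beta)}+\big(\|f\|_{\mathcal B_{m,T}}+\|\Pi_\varepsilon\|_{\mathcal B_{m,T}}\big)\frac{(T-t)^{1-\gamma(1+\beta)}}{1-\gamma(1+\beta)}\Big]\|x-y\|_H^\beta.$$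
   Context: Setting. $T>0$ is a fixed horizon; $H$ and $\Xi$ are real separable Hilbert spaces with their Borel $\sigma$-algebras; $\mathcal L_2(\Xi,H)$ is the space of Hilbert–Schmidt operators. $(\Omega,\mathcal F,\mathbb F=\{\mathcal F_s\}_{s\ge0},\mathbb P)$ is a filtered probability space satisfying the usual conditions, and $W$ is a cylindrical $\mathbb F$-Wiener process on $\Xi$. Weighted spaces. Fix $m\ge1$ and set $w_m(x):=1+\|x\|_H^m$. $\mathcal B_m(H)$ is the space of Borel maps $\varphi:H\to\mathbb R$ with $\|\varphi\|_{\mathcal B_m}:=\sup_x|\varphi(x)|/w_m(x)<\infty$; $\mathcal B_m([0,T]\times H)$ is the space of Borel maps $\psi:[0,T]\times H\to\mathbb R$ with $\|\psi\|_{\mathcal B_{m,T}}:=\sup_{(t,x)}|\psi(t,x)|/w_m(x)<\infty$. $\mathcal C_m(H)$ and $\mathcal C_m([0,T]\times H)$ are the subspaces of (jointly) continuous maps. $\mathrm{Lip}_m(H)$ is the set of $\varphi\in\mathcal C_m(H)$ such that for some $K>0$, $|\varphi(x)-\varphi(y)|\le K(1+\|x\|_H^{m-1}+\|y\|_H^{m-1})\|x-y\|_H$ for all $x,y\in H$; $\mathrm{Lip}_m([0,T]\times H)$ is the set of $\psi\in\mathcal C_m([0,T]\times H)$ satisfying this estimate for $\psi(t,\cdot)$ with $K$ independent of $t\in[0,T]$. Coefficient assumptions. $A:\mathrm{Dom}(A)\subset H\to H$ is closed, densely defined and generates a $C_0$-semigroup $\{e^{\tau A}\}_{\tau\ge0}$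 on $H$; $b:[0,T]\times H\to H$ and $\sigma:[0,T]\times H\to\mathcal L_2(\Xi,H)$ are Borel measurable, and there are constants $L,K>0$ with $\|b(s,x)-b(s,y)\|_H+\|\sigma(s,x)-\sigma(s,y)\|_{\mathcal L_2}\le L\|x-y\|_H$ and $\|b(s,x)\|_H+\|\sigma(s,x)\|_{\mathcal L_2}\le K(1+\|x\|_H)$ for all $s\in[0,T]$, $x,y\in H$. State process. $X(\cdot;t,x)$ is the unique continuous mild solution on $[t,T]$ of $\mathrm dX(s)=[AX(s)+b(s,X(s))]\mathrm ds+\sigma(s,X(s))\mathrm dW(s)$, $X(t)=x$, i.e. $X(s)=e^{(s-t)A}x+\int_t^se^{(s-r)A}b(r,X(r))\mathrm dr+\int_t^se^{(s-r)A}\sigma(r,X(r))\mathrm dW(r)$. For $\varphi\in\mathcal B_m(H)$ and $0\le t\le s\le T$, $P_{t,s}[\varphi](x):=\mathbb E[\varphi(X(s;t,x))]$. Smoothing assumption. For all $0\le t<s\le T$ and $\varphi\in\mathcal B_m(H)$, the map $x\mapsto P_{t,s}[\varphi](x)$ is twice continuously Fréchet differentiable on $H$, and there are constants $C_1>0$ and $\gamma\in(0,1)$ such that for all such $t,s,\varphi$ and all $x\in H$: $\|\nabla P_{t,s}[\varphi](x)\|_H\le C_1(s-t)^{-\gamma}w_m(x)\|\varphi\|_{\mathcal B_m}$ and $\|\nabla^2P_{t,s}[\varphi](x)\|_{\mathcal L(H)}\le C_1(s-t)^{-2\gamma}w_m(x)\|\varphi\|_{\mathcal B_m}$. Data assumptions.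 $f,\Phi\in\mathrm{Lip}_m([0,T]\times H)$, $\Psi\in\mathrm{Lip}_m(H)$, and $\Psi(x)\le\Phi(T,x)$ for all $x\in H$. Penalized equation. For $\varepsilon>0$, the mild solution $u_\varepsilon$ of the penalized equation is the unique $u_\varepsilon\in\mathcal B_m([0,T]\times H)$ (it exists, is unique, and lies in $\mathcal C_m([0,T]\times H)$) such that for all $(t,x)\in[0,T]\times H$ $$u_\varepsilon(t,x)=P_{t,T}[\Psi](x)+\int_t^TP_{t,s}\Big[f(s,\cdot)-\tfrac1\varepsilon\big(u_\varepsilon(s,\cdot)-\Phi(s,\cdot)\big)^+\Big](x)\,\mathrm ds.$$ *)

(* Defs.v *)
From HB Require Import structures.
From mathcomp Require Import all_boot all_order all_algebra.
From mathcomp Require Import all_classical all_reals all_analysis.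
From mathcomp Require Import measurable_realfun.

Set Implicit Arguments.
Unset Strict Implicit.
Unset Printing Implicit Defensive.

Import Order.TTheory GRing.Theory Num.Theory.
Import numFieldNormedType.Exports.

Local Open Scope classical_set_scope.
Local Open Scope ring_scope.

HB.mixin Record NormedModule_isInnerProduct (R : realType) H
    of NormedModule R H := {
  inner : H -> H -> R ;
  innerC : forall x y, inner x y = inner y x ;
  innerP : forall a x y z, inner (a *: x + y) z = a * inner x z + inner y z ;
  inner_norm : forall x, inner x x = `|x| ^+ 2
}.

#[short(type="hilbertType")]
HB.structure Definition Hilbert (R : realType) :=
  {H of CompleteNormedModule R H & NormedModule_isInnerProduct R H}.

Definition separable (T : topologicalType) : Prop :=
  exists D : set T, countable D /\ dense D.

Definition borel (R : realType) (T : normedModType R) := g_sigma_algebraType (@open T).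

Definition borel_map (R : realType) (T : normedModType R)
    (d : measure_display) (U : measurableType d) (D : set T) (f : T -> U) : Prop :=
  @measurable_fun _ _ (borel T) U D f.
Arguments borel_map {R} T {d U} D f.

Definition orthonormal_basis (R : realType) (Xi : hilbertType R) (B : set Xi)
    : Prop :=
  (forall e f, B e -> B f -> inner e f = (e == f)%:R) /\
  (forall x, (forall e, B e -> inner x e = 0) -> x = 0).

(* The sum does not depend on the basis, so that the supremum is the supremum
   of a singleton; it only avoids choosing a basis. *)
Definition hs_sqnorm (R : realType) (Xi H : hilbertType R) (Q : Xi -> H)
    : \bar R :=
  ereal_sup [set (\esum_(e in B) ((`|Q e| ^+ 2)%:E))%E
            | B in @orthonormal_basis R Xi].

Definition hilbert_schmidt (R : realType) (Xi H : hilbertType R)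
    (Q : Xi -> H) : Prop :=
  [/\ linear Q, continuous Q & (hs_sqnorm Q < +oo)%E].

Definition hs_norm (R : realType) (Xi H : hilbertType R) (Q : Xi -> H) : R :=
  Num.sqrt (fine (hs_sqnorm Q)).

(* Open sets of L_2(Xi, H), seen as a subset of the function space Xi -> H. *)
Definition hs_open (R : realType) (Xi H : hilbertType R) (O : set (Xi -> H))
    : Prop :=
  O `<=` @hilbert_schmidt R Xi H /\
  forall Q, O Q -> exists2 r : R, 0 < r &
    forall Q', hilbert_schmidt Q' -> hs_norm (Q' \- Q) < r -> O Q'.

(* Maps on [0, T] x H are represented by maps R -> H -> R of which only the
   restriction to [strip H T] matters. *)

Definition strip (R : realType) (H : hilbertType R) (T : R) : set (R * H) :=
  [set p | 0 <= p.1 <= T].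
Arguments strip {R} H T.

Definition weight (R : realType) (H : hilbertType R) (m : R) (x : H) : R :=
  1 + `|x| `^ m.

Definition Bm (R : realType) (H : hilbertType R) (m : R) (phi : H -> R)
    : Prop :=
  borel_map H setT phi /\
  has_ubound (range (fun x => `|phi x| / weight m x)).

Definition Bm_norm (R : realType) (H : hilbertType R) (m : R) (phi : H -> R)
    : R :=
  sup (range (fun x => `|phi x| / weight m x)).

Definition BmT (R : realType) (H : hilbertType R) (m T : R)
    (psi : R -> H -> R) : Prop :=
  borel_map (R * H)%type (strip H T) (fun p => psi p.1 p.2) /\
  has_ubound [set `|psi p.1 p.2| / weight m p.2 | p in strip H T].

Definition BmT_norm (R : realType) (H : hilbertType R) (m T : R)
    (psi : R -> H -> R) : R :=
  sup [set `|psi p.1 p.2| / weight m p.2 | p in strip H T].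

Definition Cm (R : realType) (H : hilbertType R) (m : R) (phi : H -> R)
    : Prop :=
  Bm m phi /\ continuous phi.

Definition CmT (R : realType) (H : hilbertType R) (m T : R)
    (psi : R -> H -> R) : Prop :=
  BmT m T psi /\
  {within strip H T, continuous (fun p : R * H => psi p.1 p.2)}.

Definition weighted_lipschitz (R : realType) (H : hilbertType R) (m K : R)
    (phi : H -> R) : Prop :=
  forall x y, `|phi x - phi y| <=
    K * (1 + `|x| `^ (m - 1) + `|y| `^ (m - 1)) * `|x - y|.

Definition Lipm (R : realType) (H : hilbertType R) (m : R) (phi : H -> R)
    : Prop :=
  Cm m phi /\ exists2 K : R, 0 < K & weighted_lipschitz m K phi.

Definition LipmT (R : realType) (H : hilbertType R) (m T : R)
    (psi : R -> H -> R) : Prop :=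
  CmT m T psi /\
  exists2 K : R, 0 < K & forall t : R, 0 <= t <= T -> weighted_lipschitz m K (psi t).

(* Riesz representative in H of the Frechet derivative. *)
Definition grad (R : realType) (H : hilbertType R) (phi : H -> R) (x : H)
    : H :=
  xget 0 [set g | forall h, 'd (phi : H -> R^o) x h = inner g h].

Definition hess (R : realType) (H : hilbertType R) (phi : H -> R) (x : H)
    : H -> H :=
  'd (grad phi) x.

Definition op_norm (R : realType) (H : hilbertType R) (Q : H -> H) : R :=
  sup [set `|Q h| | h in [set h | `|h| <= 1]].

Definition frechet_C1 (R : realType) (H : hilbertType R) (phi : H -> R)
    : Prop :=
  (forall x, differentiable (phi : H -> R^o) x) /\ continuous (grad phi).

Definition frechet_C2 (R : realType) (H : hilbertType R) (phi : H -> R)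
    : Prop :=
  [/\ frechet_C1 phi,
      forall x, differentiable (grad phi) x &
      forall x, op_norm (hess phi y \- hess phi x) @[y --> x] --> 0].

Definition usual_filtration (R : realType) (d : measure_display)
    (Omega : measurableType d) (P : probability Omega R)
    (F : R -> set (set Omega)) : Prop :=
  [/\ forall s : R, 0 <= s -> sigma_algebra setT (F s) /\ F s `<=` measurable,
      forall r s : R, 0 <= r <= s -> F r `<=` F s,
      forall s : R, 0 <= s -> \bigcap_(r in [set r : R | s < r]) F r `<=` F s &
      forall N, P.-negligible N -> F 0 N].

(* [W s xi] is the real random variable usually written <W(s), xi>; the
   covariance of [W s xi] and [W s eta] follows by polarization. *)
Definition cylindrical_wiener (R : realType) (Xi : hilbertType R)
    (d : measure_display) (Omega : measurableType d) (P : probability Omega R)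
    (F : R -> set (set Omega)) (W : R -> Xi -> Omega -> R) : Prop :=
  [/\ forall (s a : R) (xi eta : Xi), 0 <= s ->
        {ae P, forall w, W s (a *: xi + eta) w = a * W s xi w + W s eta w},
      forall xi, {ae P, forall w, W 0 xi w = 0} /\
        {ae P, forall w,
          {within [set s : R | 0 <= s], continuous (fun s => W s xi w)}},
      forall (s : R) (xi : Xi) (B : set R), 0 <= s -> measurable B ->
        F s (W s xi @^-1` B),
      forall (r s : R) (xi : Xi) (B : set R), 0 <= r < s -> xi != 0 -> measurable B ->
        P [set w | B (W s xi w - W r xi w)] =
          normal_prob 0 (Num.sqrt (s - r) * `|xi|) B &
      forall (r s : R) (xi : Xi) (E : set Omega) (B : set R), 0 <= r < s -> F r E ->
        measurable B ->
        P (E `&` [set w | B (W s xi w - W r xi w)]) =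
          (P E * P [set w | B (W s xi w - W r xi w)%R])%E].

Definition bochner_integral (R : realType) (H : hilbertType R) (a b : R)
    (g : R -> H) (v : H) : Prop :=
  exists (k : nat -> nat) (E : nat -> nat -> set R) (h : nat -> nat -> H),
    let G n r := \sum_(i < k n) (\1_(E n i) r : R) *: h n i in
    [/\ forall n i, measurable (E n i),
        forall n, measurable_fun `[a, b] (fun r => `|G n r - g r|),
        (\int[lebesgue_measure]_(r in `[a, b]) (`|G n r - g r|)%:E)%E
          @[n --> \oo] --> 0%E &
        (\sum_(i < k n) fine (lebesgue_measure (E n i `&` `[a, b])) *: h n i)
          @[n --> \oo] --> v].

Definition cvg_in_probability0 (R : realType) (d : measure_display)
    (Omega : measurableType d) (P : probability Omega R)
    (Y : nat -> Omega -> \bar R) : Prop :=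
  forall e : R, 0 < e ->
    P [set w | (e%:E < Y n w)%E] @[n --> \oo] --> 0%E.

(* The elementary finite-rank process
   (r, w) |-> 1_{]lo, hi]}(r) 1_{event}(w) <source, .> target. *)
Record step (R : realType) (Xi H : hilbertType R) (Omega : Type) := Step {
  lo : R ; hi : R ; event : set Omega ; source : Xi ; target : H }.

Definition step_process (R : realType) (Xi H : hilbertType R) (Omega : Type)
    (c : step Xi H Omega) (r : R) (w : Omega) (xi : Xi) : H :=
  (\1_(`]lo c, hi c]) r * \1_(event c) w * inner (source c) xi) *: target c.

Definition step_integral (R : realType) (Xi H : hilbertType R) (Omega : Type)
    (W : R -> Xi -> Omega -> R) (c : step Xi H Omega) (w : Omega) : H :=
  (\1_(event c) w * (W (hi c) (source c) w - W (lo c) (source c) w))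
    *: target c.

(* [I] is (a version of) the Ito integral over [a, b] of the
   L_2(Xi, H)-valued process [Z] against [W]: the limit in probability of the
   integrals of adapted elementary processes that converge to [Z] in
   L^2([a, b]; L_2(Xi, H)), in probability. *)
Definition ito_integral (R : realType) (Xi H : hilbertType R)
    (d : measure_display) (Omega : measurableType d) (P : probability Omega R)
    (F : R -> set (set Omega)) (W : R -> Xi -> Omega -> R) (a b : R)
    (Z : R -> Omega -> Xi -> H) (I : Omega -> H) : Prop :=
  exists (k : nat -> nat) (c : nat -> nat -> step Xi H Omega),
    let D n r w :=
      hs_sqnorm ((fun xi => \sum_(i < k n) step_process (c n i) r w xi)
                 \- Z r w) in
    [/\ forall n i, a <= lo (c n i) <= hi (c n i) /\ hi (c n i) <= b /\
          F (lo (c n i)) (event (c n i)),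
        forall n, measurable_fun (`[a, b] `*` setT)
          ((fun p => D n p.1 p.2) :
             (measurableTypeR R * Omega)%type -> \bar R),
        cvg_in_probability0 P
          (fun n w => (\int[lebesgue_measure]_(r in `[a, b]) D n r w)%E),
        measurable_fun setT (I : Omega -> borel H) &
        cvg_in_probability0 P
          (fun n w =>
             (`|\sum_(i < k n) step_integral W (c n i) w - I w|)%:E)].

Definition C0_semigroup (R : realType) (H : hilbertType R) (S : R -> H -> H)
    : Prop :=
  [/\ forall x, S 0 x = x,
      forall (r s : R) (x : H), 0 <= r -> 0 <= s -> S (r + s) x = S r (S s x),
      forall r : R, 0 <= r -> linear (S r) /\ continuous (S r) &
      forall x, S r x @[r --> 0^'+] --> x].

(* The unbounded operator A is given by its domain [DomA] and a map whose
   values outside [DomA] are irrelevant. *)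
Definition linear_operator (R : realType) (H : hilbertType R) (DomA : set H)
    (A : H -> H) : Prop :=
  DomA 0 /\
  forall a x y, DomA x -> DomA y ->
    DomA (a *: x + y) /\ A (a *: x + y) = a *: A x + A y.

Definition closed_operator (R : realType) (H : hilbertType R) (DomA : set H)
    (A : H -> H) : Prop :=
  closed [set p : H * H | DomA p.1 /\ A p.1 = p.2].

Definition generates (R : realType) (H : hilbertType R) (DomA : set H)
    (A : H -> H) (S : R -> H -> H) : Prop :=
  C0_semigroup S /\
  forall x y, (DomA x /\ A x = y) <->
    (r^-1 *: (S r x - x) @[r --> 0^'+] --> y).

Definition lipschitz_coefficients (R : realType) (Xi H : hilbertType R)
    (T : R) (b : R -> H -> H) (sigma : R -> H -> Xi -> H) : Prop :=
  [/\ borel_map (R * H)%type (strip H T) ((fun p => b p.1 p.2) : _ -> borel H),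
      forall (s : R) (x : H), 0 <= s <= T -> hilbert_schmidt (sigma s x),
      borel_map (R * H)%type (strip H T) ((fun p => sigma p.1 p.2) :
        _ -> g_sigma_algebraType (@hs_open R Xi H)) &
      exists L K : R, [/\ 0 < L, 0 < K,
        forall (s : R) (x y : H), 0 <= s <= T ->
          `|b s x - b s y| + hs_norm (sigma s x \- sigma s y)
            <= L * `|x - y| &
        forall (s : R) (x : H), 0 <= s <= T ->
          `|b s x| + hs_norm (sigma s x) <= K * (1 + `|x|)]].

Definition mild_state (R : realType) (Xi H : hilbertType R)
    (d : measure_display) (Omega : measurableType d) (P : probability Omega R)
    (F : R -> set (set Omega)) (W : R -> Xi -> Omega -> R) (T : R)
    (S : R -> H -> H) (b : R -> H -> H) (sigma : R -> H -> Xi -> H)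
    (t : R) (x : H) (X : R -> Omega -> H) : Prop :=
  [/\ forall (s : R) (B : set (borel H)), t <= s <= T -> measurable B ->
        F s (X s @^-1` B),
      forall w, {within `[t, T], continuous (fun s => X s w)} &
      forall s : R, t <= s <= T -> exists D I : Omega -> H,
        [/\ {ae P, forall w,
              bochner_integral t s (fun r => S (s - r) (b r (X r w))) (D w)},
            ito_integral P F W t s
              (fun r w xi => S (s - r) (sigma r (X r w) xi)) I &
            {ae P, forall w, X s w = S (s - t) x + D w + I w}]].

(* [X t x s] is X(s;t,x). *)
Definition transition (R : realType) (H : hilbertType R)
    (d : measure_display) (Omega : measurableType d) (P : probability Omega R)
    (X : R -> H -> R -> Omega -> H) (t s : R) (phi : H -> R) (x : H) : R :=
  fine 'E_P[fun w => phi (X t x s w)].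

Definition smoothing (R : realType) (H : hilbertType R) (m T : R)
    (Pts : R -> R -> (H -> R) -> H -> R) (C1 gamma : R) : Prop :=
  forall (t s : R) (phi : H -> R), 0 <= t -> t < s -> s <= T -> Bm m phi ->
    frechet_C2 (Pts t s phi) /\
    forall x,
      `|grad (Pts t s phi) x| <=
        C1 * (s - t) `^ (- gamma) * weight m x * Bm_norm m phi /\
      op_norm (hess (Pts t s phi) x) <=
        C1 * (s - t) `^ (- (2 * gamma)) * weight m x * Bm_norm m phi.

Definition penalty (R : realType) (H : hilbertType R) (eps : R)
    (u Phi : R -> H -> R) (s : R) (x : H) : R :=
  eps^-1 * Num.max (u s x - Phi s x) 0.

Definition mild_penalized (R : realType) (H : hilbertType R) (m T : R)
    (Pts : R -> R -> (H -> R) -> H -> R) (f Phi : R -> H -> R) (Psi : H -> R)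
    (eps : R) (u : R -> H -> R) : Prop :=
  BmT m T u /\
  forall (t : R) (x : H), 0 <= t <= T ->
    u t x = Pts t T Psi x +
      \int[lebesgue_measure]_(s in `[t, T])
        Pts t s (fun y => f s y - penalty eps u Phi s y) x.

(* Main.v *)
Require Import Defs.
From HB Require Import structures.
From mathcomp Require Import all_boot all_order all_algebra.
From mathcomp Require Import all_classical all_reals all_analysis.
From mathcomp Require Import measurable_realfun.
From mathcomp Require Import ring lra.

(** The mild equation writes [u t] as [P_{t,T}[Psi]] plus the integral over
    [s] in [[t, T]] of [F_s = P_{t,s}[f_s - Pi_s]], where the weighted norm of
    [f_s - Pi_s] is at most [N] for every [s]. Smoothing gives [F_s] a gradient
    of order [(s - t)^(-gamma)], integrable in time, and a Hessian of order
    [(s - t)^(-2 gamma)], integrable only when [gamma < 1/2]. Interpolating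
    between the two ([smoothing_holder]) shows that the gradient of [F_s] is
    locally [beta]-Holder with a constant of order [(s - t)^(-gamma (1 + beta))],
    which is integrable as soon as [gamma (1 + beta) < 1].

    This Holder bound serves twice. Integrated in time, it is the estimate (ii).
    Through the mean value theorem it also bounds the first-order remainder of
    [F_s] by [|y - x|^(1 + beta)] times an integrable function of [s]; hence the
    integral of the gradients, a vector of [H] by Riesz's theorem ([riesz]), is
    the Frechet gradient of the integral ([has_grad_integral]). The estimate (i)
    is then the integral of the bound on the gradient of [F_s], and the powers of
    [T - t] are the integrals of the kernels ([Rintegral_powR_singular]).

    Two facts on the time integral are needed. First, [s |-> F_s(x)] must be
    measurable: the state is a jointly measurable function of time and chance,
    being a limit of samplings on time grids ([measurable_time_state]), and
    Tonelli's theorem applies ([measurable_expectation]). Second, [s |-> F_s(x)]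
    must be integrable. The gradient bound makes the increments in [x]
    integrable, so that integrability holds at every point or at none. In the
    second case the real-valued integral is the constant [0], and the estimates
    for [P_{t,T}[Psi]] alone imply the claim ([duhamel_estimates]). *)

Import Order.TTheory GRing.Theory Num.Theory.
Import numFieldNormedType.Exports.

Local Open Scope classical_set_scope.
Local Open Scope ring_scope.

(** * Inner products and the Riesz representation *)

Section InnerProduct.
Context {R : realType} {H : hilbertType R}.
Implicit Types x y z g h : H.

Lemma innerDl x y z : inner (x + y) z = inner x z + inner y z.
Proof. by have := innerP 1 x y z; rewrite scale1r mul1r. Qed.

Lemma inner0l z : inner 0 z = 0.
Proof.
have := innerDl 0 0 z; rewrite addr0 => /eqP.
by rewrite -subr_eq subrr eq_sym => /eqP.
Qed.

Lemma innerZl a x z : inner (a *: x) z = a * inner x z.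
Proof. by have := innerP a x 0 z; rewrite addr0 inner0l addr0. Qed.

Lemma innerNl x z : inner (- x) z = - inner x z.
Proof. by rewrite -scaleN1r innerZl mulN1r. Qed.

Lemma innerBl x y z : inner (x - y) z = inner x z - inner y z.
Proof. by rewrite innerDl innerNl. Qed.

Lemma innerDr x y z : inner z (x + y) = inner z x + inner z y.
Proof. by rewrite innerC innerDl !(innerC z). Qed.

Lemma innerZr a x z : inner z (a *: x) = a * inner z x.
Proof. by rewrite innerC innerZl (innerC z). Qed.

Lemma innerBr x y z : inner z (x - y) = inner z x - inner z y.
Proof. by rewrite innerC innerBl !(innerC z). Qed.

Lemma inner0r z : inner z 0 = 0.
Proof. by rewrite innerC inner0l. Qed.

(** Expands the nonnegative square of [|y|^2 x - <x,y> y]. *)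
Lemma cauchy_schwarz x y : `|inner x y| <= `|x| * `|y|.
Proof.
have [->|y0] := eqVneq y 0; first by rewrite inner0r !normr0 mulr0.
have yy : 0 < `|y| ^+ 2 by rewrite exprn_gt0 // normr_gt0.
have := sqr_ge0 `|(`|y| ^+ 2) *: x - inner x y *: y|.
rewrite -inner_norm innerBl !innerBr !innerZl !innerZr !inner_norm (innerC y x).
set c := inner x y => E.
have : 0 <= `|y| ^+ 2 * ((`|x| * `|y|) ^+ 2 - c ^+ 2).
  by apply: (le_trans E); rewrite le_eqVlt; apply/orP; left; apply/eqP; ring.
rewrite pmulr_rge0 // subr_ge0 => E2.
by rewrite -(@ler_pXn2r _ 2) ?nnegrE ?mulr_ge0 // real_normK ?num_real.
Qed.

Lemma norm_le_dual g B : 0 <= B -> (forall h, inner g h <= B * `|h|) -> `|g| <= B.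
Proof.
move=> B0 gB; have [->|g0] := eqVneq g 0; first by rewrite normr0.
have g_gt0 : 0 < `|g| by rewrite normr_gt0.
by have := gB g; rewrite inner_norm expr2 ler_pM2r.
Qed.

Lemma inner_ext g g' : (forall h, inner g h = inner g' h) -> g = g'.
Proof.
move=> gg'; apply/eqP; rewrite -subr_eq0 -normr_le0; apply: norm_le_dual => // h.
by rewrite innerBl gg' subrr mul0r.
Qed.

Lemma inner_lin_continuous g : continuous (inner g : H -> R).
Proof.
move=> x; apply/cvgrPdist_le => e e0.
have g1 : 0 < `|g| + 1 by rewrite ltr_wpDl.
near=> y; rewrite -innerBr; apply: (le_trans (cauchy_schwarz _ _)).
have : `|x - y| <= e / (`|g| + 1).
  by near: y; apply: cvgr_dist_le; [exact: cvg_id|rewrite divr_gt0].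
rewrite ler_pdivlMr // => xy; apply: le_trans xy.
by rewrite mulrC ler_wpM2l // lerDl.
Unshelve. all: by end_near. Qed.

(** A bounded functional [l] is represented by the minimizer of
    [|x|^2 - 2 l x]: the parallelogram law makes every minimizing sequence
    Cauchy, and the first-order condition at the limit is the claim. *)
Lemma riesz (l : H -> R) (M : R) :
  (forall a x y, l (a *: x + y) = a * l x + l y) ->
  (forall x, `|l x| <= M * `|x|) -> exists g, forall h, l h = inner g h.
Proof.
move=> lP lM.
have lD x y : l (x + y) = l x + l y by rewrite -[x]scale1r lP mul1r scale1r.
have l0 : l 0 = 0 by apply/eqP; rewrite -normr_le0 (le_trans (lM _)) // normr0 mulr0.
have lZ a x : l (a *: x) = a * l x by rewrite -[a *: x]addr0 lP l0 addr0.
pose J (x : H) : R := `|x| ^+ 2 - 2 * l x.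
have JD x h : J (x + h) = J x + `|h| ^+ 2 + 2 * (inner x h - l h).
  rewrite /J -!inner_norm innerDl !innerDr lD (innerC h x); ring.
have J_lb : has_inf (range J).
  split; first by exists (J 0), 0.
  exists (- M ^+ 2) => _ [x _ <-]; rewrite /J.
  have := lM x; have := sqr_ge0 (`|x| - M); have := ler_norm (l x).
  by set a := `|x|; set b := `|l x|; nra.
set mu := inf (range J).
have muJ x : mu <= J x by apply: ge_inf; [exact: J_lb.2|exists x].
have /choice [u uJ] : forall n : nat, exists x, J x < mu + n.+1%:R^-1.
  move=> n; have [|_ [x _ <-] ?] := @inf_adherent _ _ n.+1%:R^-1 _ J_lb.
    by rewrite invr_gt0.
  by exists x.
have parallelogram x y :
    `|x - y| ^+ 2 = 2 * J x + 2 * J y - 4 * J (2^-1 *: (x + y)).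
  rewrite /J -!inner_norm innerZl innerZr innerBl innerDl !innerBr !innerDr.
  by rewrite lZ lD (innerC y x); field.
have natV_lt (e : R) : 0 < e -> \forall n \near \oo, n.+1%:R^-1 < e.
  by move=> e0; exact: (near_infty_natSinv_lt (PosNum e0)).
have u_cauchy : cauchy (u @ \oo).
  apply/cauchy_ballP => e' e'0.
  pose e : R := e'; have e0 : 0 < e by []; rewrite -[e']/e.
  rewrite near_map2; near=> i j.
  rewrite -ball_normE /ball_ /=.
  suff : `|u i - u j| ^+ 2 < e ^+ 2 by rewrite ltr_pXn2r // nnegrE // ltW.
  rewrite parallelogram.
  have := muJ (2^-1 *: (u i + u j)); have := uJ i; have := uJ j.
  have : i.+1%:R^-1 < e ^+ 2 / 4.
    by near: i; apply: natV_lt; rewrite divr_gt0 // exprn_gt0.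
  have : j.+1%:R^-1 < e ^+ 2 / 4.
    by near: j; apply: natV_lt; rewrite divr_gt0 // exprn_gt0.
  move: (e ^+ 2 : R) (i.+1%:R^-1 : R) (j.+1%:R^-1 : R) => e2 a b.
  lra.
have /cauchy_cvgP/cvg_ex[x ux] := u_cauchy.
have quad (h : H) (tau : R) : 0 <= tau ^+ 2 * `|h| ^+ 2 + 2 * (tau * (inner x h - l h)).
  rewrite -[leRHS]addr0; apply/ler_addgt0Pr => e e0.
  have : \forall n \near \oo, n.+1%:R^-1 < e / 2 by apply: natV_lt; rewrite divr_gt0.
  have c0 : 0 < 2 * `|tau| * `|h| + 1 by rewrite ltr_wpDl // !mulr_ge0.
  have : \forall n \near \oo, `|x - u n| <= (e / 2) / (2 * `|tau| * `|h| + 1).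
    by move/cvgrPdist_le: ux; apply; rewrite !divr_gt0.
  move=> un nn; near \oo => n.
  have : `|x - u n| <= (e / 2) / (2 * `|tau| * `|h| + 1) by near: n.
  have : n.+1%:R^-1 < e / 2 by near: n.
  rewrite ler_pdivlMr //; have := uJ n; have := muJ (u n + tau *: h).
  rewrite JD innerZr lZ normrZ exprMn real_normK ?num_real //.
  have : tau * (inner (u n) h - inner x h) <= `|tau| * (`|h| * `|x - u n|).
    apply: (le_trans (ler_norm _)); rewrite normrM ler_wpM2l // -innerBl distrC mulrC.
    exact: cauchy_schwarz.
  have := normr_ge0 (x - u n).
  move: (n.+1%:R^-1 : R) => a; set b := `|h|; set c := `|tau|; lra.
exists x => h; apply/eqP; rewrite eq_sym -subr_eq0; apply/eqP.
set c := _ - _; have a1 : 0 < `|h| ^+ 2 + 1 by rewrite ltr_wpDl // sqr_ge0.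
(* This step makes the quadratic expression negative unless [c = 0]. *)
have := quad h (- (c / (`|h| ^+ 2 + 1))); rewrite -/c.
set b := `|h| ^+ 2 in a1 *; set k := c / (b + 1) => q.
have ck : c = k * (b + 1) by rewrite /k divfK // gt_eqF.
have b0 : 0 <= b by rewrite sqr_ge0.
have : k ^+ 2 <= 0 by move: q; rewrite ck; have := sqr_ge0 k; nra.
by rewrite le_eqVlt ltNge sqr_ge0 orbF sqrf_eq0 ck => /eqP ->; rewrite mul0r.
Unshelve. all: by end_near. Qed.

End InnerProduct.

(** * Gradients as first-order expansions *)

Section Gradient.
Context {R : realType} {H : hilbertType R}.
Implicit Types (x y z g h : H) (phi : H -> R).

Definition inner_lin g : H -> R^o := inner g.

Lemma inner_lin_is_linear g : linear (inner_lin g).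
Proof. by move=> a x y; rewrite /inner_lin innerDr innerZr. Qed.

HB.instance Definition _ g :=
  GRing.isLinear.Build R H R^o _ (inner_lin g) (inner_lin_is_linear g).

(** First-order expansion along a prescribed vector. Unlike [grad], it involves
    no choice, so that it can be checked on a candidate and then determines the
    gradient ([has_gradP]). *)
Definition has_grad phi x g := forall e : R, 0 < e ->
  \forall y \near x, `|phi y - phi x - inner g (y - x)| <= e * `|y - x|.

Lemma has_gradP phi x g : has_grad phi x g ->
  differentiable (phi : H -> R^o) x /\ grad phi x = g.
Proof.
move=> hg.
have gc : continuous (inner_lin g) by exact: inner_lin_continuous.
have E : (phi : H -> R^o) \o shift x = cst (phi x : R^o) + inner_lin g +o_ 0 id.
  apply/eqaddoP => e e0; rewrite near_simpl.
  have /nbhs0P := hg e e0; apply: filterS => h /=.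
  by rewrite [x + h]addrC addrK !fctE /= /inner_lin opprD addrA.
have dE : 'd (phi : H -> R^o) x = inner_lin g :> (H -> R^o).
  exact: (@diff_unique _ _ _ _ (inner_lin g)).
split; first by apply/diff_locallyP; rewrite dE.
rewrite /grad; case: xgetP => [g' _ /= g'P|/(_ g)/=]; last by rewrite dE.
by apply: inner_ext => h; rewrite -g'P dE.
Qed.

(** [grad] is chosen among the representatives of the differential; Riesz's
    theorem provides one, so that its default value never occurs. *)
Lemma differentiable_diff_grad phi x : differentiable (phi : H -> R^o) x ->
  forall h, 'd (phi : H -> R^o) x h = inner (grad phi x) h.
Proof.
move=> dphi; have dc := diff_continuous dphi.
have [M _ dM] := linear_lipschitz dc.
have [a y z|g dg] := riesz ('d (phi : H -> R^o) x) M _ dM; first exact: linearP.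
rewrite /grad; case: xgetP => [//|/(_ g)/= /(_ dg) //].
Qed.

Lemma differentiable_has_grad phi x : differentiable (phi : H -> R^o) x ->
  has_grad phi x (grad phi x).
Proof.
move=> dphi e e0; have /diff_locallyP[_ /eqaddoP/(_ e e0)] := dphi.
rewrite near_simpl => E; apply/nbhs0P; apply: filterS E => h /=.
by rewrite !fctE /= [x + h]addrC addrK opprD addrA differentiable_diff_grad.
Qed.

Lemma has_gradD phi psi x g g' :
  has_grad phi x g -> has_grad psi x g' -> has_grad (phi \+ psi) x (g + g').
Proof.
move=> hg hg' e e0; have e2 : 0 < e / 2 by rewrite divr_gt0.
near=> y; rewrite innerDl /=.
have : `|phi y - phi x - inner g (y - x)| <= e / 2 * `|y - x|.
  by near: y; exact: hg.
have : `|psi y - psi x - inner g' (y - x)| <= e / 2 * `|y - x|.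
  by near: y; exact: hg'.
set a := psi y - _ - _; set b := phi y - _ - _; set c := `|y - x| => aP bP.
have -> : phi y + psi y - (phi x + psi x) - (inner g (y - x) + inner g' (y - x))
  = a + b by rewrite /a /b; ring.
by apply: (le_trans (ler_normD _ _)); lra.
Unshelve. all: by end_near. Qed.

Lemma mean_value_line {V : normedModType R} (phi : V -> R^o) (x y : V) :
  (forall z : V, differentiable phi z) ->
  exists2 c : R, 0 <= c <= 1 &
    phi y - phi x = 'd phi (x + c *: (y - x)) (y - x).
Proof.
move=> dphi; pose line (s : R) : V := x + s *: (y - x).
have dline s : is_diff (s : R) line ( *:%R ^~ (y - x)).
  by apply: is_diff_eq; rewrite add0r.
have dF s : is_derive (s : R) 1 ((phi \o line : R -> R^o) : R -> R)
    ('d phi (line s) (y - x)).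
  have dl : differentiable line s by apply: ex_diff.
  have dc : differentiable (phi \o line) s by apply: differentiable_comp.
  split; first exact: diff_derivable.
  by rewrite deriveE // diff_comp //= diff_val scale1r.
have cF : {within `[0, 1], continuous (phi \o line : R -> R)}.
  by apply: derivable_within_continuous => s _; case: (dF s).
have [c] := MVT_segment ler01 (fun s _ => dF s) cF.
rewrite in_itv /= subr0 mulr1 /line scale1r scale0r addr0 subrKC.
by exists c.
Qed.

End Gradient.

(** * Mean value estimates and interpolation *)

Section MeanValue.
Context {R : realType} {H : hilbertType R}.
Implicit Types (x y z g h : H) (phi : H -> R).

Lemma segment_in_ball x y (r c : R) : `|x| <= r -> `|y| <= r -> 0 <= c <= 1 ->
  `|x + c *: (y - x)| <= r.
Proof.
move=> xr yr /andP[c0 c1].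
have -> : x + c *: (y - x) = (1 - c) *: x + c *: y.
  by rewrite scalerBr scalerBl scale1r addrAC addrA.
apply: (le_trans (ler_normD _ _)); rewrite !normrZ !ger0_norm // ?subr_ge0 //.
by move: (`|x|) (`|y|) xr yr => a b; nra.
Qed.

Lemma lipschitz_on_ball phi (r B : R) :
  (forall z, differentiable (phi : H -> R^o) z) ->
  (forall z, `|z| <= r -> `|grad phi z| <= B) ->
  forall x y, `|x| <= r -> `|y| <= r -> `|phi y - phi x| <= B * `|y - x|.
Proof.
move=> dphi gB x y xr yr; have [c c01 E] := mean_value_line phi x y dphi.
rewrite [_ - _]E differentiable_diff_grad //.
apply: (le_trans (cauchy_schwarz _ _)).
by rewrite ler_wpM2r // gB // segment_in_ball.
Qed.

(** A pointwise bound on the first-order remainder, rather than its mere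
    negligibility, is what survives an integration over a parameter. *)
Lemma remainder_on_ball phi (r C beta : R) : 0 <= C -> 0 <= beta ->
  (forall z, differentiable (phi : H -> R^o) z) ->
  (forall x y, `|x| <= r -> `|y| <= r ->
    `|grad phi x - grad phi y| <= C * `|x - y| `^ beta) ->
  forall x y, `|x| <= r -> `|y| <= r ->
  `|phi y - phi x - inner (grad phi x) (y - x)| <= C * `|y - x| `^ beta * `|y - x|.
Proof.
move=> C0 beta0 dphi gC x y xr yr.
have [c /[dup] c01 /andP[c0 c1] E] := mean_value_line phi x y dphi.
rewrite [phi y - _]E differentiable_diff_grad // -innerBl.
apply: (le_trans (cauchy_schwarz _ _)); rewrite ler_wpM2r //.
apply: (le_trans (gC _ _ _ _)) => //; first exact: segment_in_ball.
rewrite ler_wpM2l // ge0_ler_powR ?nnegrE //.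
by rewrite addrAC subrr add0r normrZ ger0_norm // ler_piMl.
Qed.

Lemma op_norm_ub (Q : {linear H -> H}) h : continuous Q -> `|h| <= 1 ->
  `|Q h| <= op_norm Q.
Proof.
move=> Qc h1; have [M M0 QM] := linear_lipschitz Qc.
apply: ub_le_sup; last by exists h.
exists M => _ [k /= k1 <-]; apply: (le_trans (QM k)).
by rewrite ler_piMr // ltW.
Qed.

Lemma ler_op_norm (Q : {linear H -> H}) h : continuous Q ->
  `|Q h| <= op_norm Q * `|h|.
Proof.
move=> Qc; have [->|h0] := eqVneq h 0; first by rewrite linear0 !normr0 mulr0.
have h1 : 0 < `|h| by rewrite normr_gt0.
rewrite -ler_pdivrMr // mulrC -[`|h|^-1]ger0_norm ?invr_ge0 // -normrZ -linearZ.
apply: op_norm_ub => //.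
by rewrite normrZ ger0_norm ?invr_ge0 // mulVf ?gt_eqF.
Qed.

(** The mean value equality holds for scalar functions only; it is applied to the
    component of the gradient along the increment that is to be bounded. *)
Lemma grad_lipschitz_on_ball phi (r B : R) : frechet_C2 phi ->
  (forall z, `|z| <= r -> op_norm (hess phi z) <= B) ->
  forall x y, `|x| <= r -> `|y| <= r ->
  `|grad phi x - grad phi y| <= B * `|x - y|.
Proof.
move=> [_ dgrad _] hB x y xr yr.
set v := grad phi x - grad phi y.
have [->|v0] := eqVneq v 0.
  rewrite normr0 mulr_ge0 // (le_trans _ (hB x xr)) //.
  by apply: le_trans (op_norm_ub _ 0 (diff_continuous (dgrad x)) _); rewrite ?normr0.
have dv z : differentiable (inner_lin v \o grad phi) z.
  apply: differentiable_comp => //; apply: linear_differentiable.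
  exact: inner_lin_continuous.
have [c c01] := mean_value_line (inner_lin v \o grad phi) y x dv.
have vc : continuous (inner_lin v) by exact: inner_lin_continuous.
rewrite diff_comp //=; last exact: linear_differentiable.
rewrite diff_lin // /inner_lin -innerBr inner_norm => E.
have : `|v| ^+ 2 <= `|v| * (B * `|x - y|).
  rewrite E; apply: (le_trans (ler_norm _)); apply: (le_trans (cauchy_schwarz _ _)).
  rewrite ler_wpM2l //; apply: (le_trans (ler_op_norm _ _ _)).
    exact: diff_continuous.
  by rewrite ler_wpM2r // hB // segment_in_ball.
by rewrite expr2 ler_pM2l // normr_gt0.
Qed.

(** Used with [A] a uniform bound and [D] a Lipschitz bound of the same
    increment, this yields a Holder bound of exponent [beta]. *)
Lemma interpolation_le (v A D beta : R) : 0 <= v -> 0 <= beta <= 1 ->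
  v <= A -> v <= D -> v <= A `^ (1 - beta) * D `^ beta.
Proof.
move=> v0 /andP[b0 b1] vA vD.
have -> : v = v `^ (1 - beta) * v `^ beta.
  by rewrite -powRD subrK ?powRr1 // oner_eq0.
by apply: ler_pM; rewrite ?powR_ge0 // ge0_ler_powR ?nnegrE ?subr_ge0 //;
  exact: le_trans vA || exact: le_trans vD.
Qed.

(** On a ball the gradient is bounded by a multiple of [(s - t)^(-gamma)] and
    Lipschitz with constant of order [(s - t)^(-2 gamma)]. Interpolation gives
    the rate [gamma (1 - beta) + 2 gamma beta = gamma (1 + beta)]; the factor
    [2^(1 - beta)] is there because an increment is at most twice a bound. *)
Lemma smoothing_holder (m T C1 gamma : R) (P : R -> R -> (H -> R) -> H -> R)
    (t s r beta : R) phi :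
  0 <= m -> 0 <= C1 -> smoothing m T P C1 gamma ->
  0 <= t -> t < s -> s <= T -> Bm m phi -> 0 < beta < 1 ->
  forall x y, `|x| <= r -> `|y| <= r ->
  `|grad (P t s phi) x - grad (P t s phi) y| <=
    2 `^ (1 - beta) * C1 * (1 + r `^ m) * (s - t) `^ (- (gamma * (1 + beta)))
      * Bm_norm m phi * `|x - y| `^ beta.
Proof.
move=> m0 C0 hP t0 ts sT Bphi /andP[b0 b1] x y xr yr.
have [C2 est] := hP t s phi t0 ts sT Bphi.
have n0 : 0 <= Bm_norm m phi.
  apply: le_trans (ub_le_sup Bphi.2 _); last by exists 0.
  by rewrite divr_ge0 // addr_ge0 // powR_ge0.
have st : 0 < s - t by rewrite subr_gt0.
have r0 : 0 <= r by exact: le_trans xr.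
have wr z : `|z| <= r -> weight m z <= 1 + r `^ m.
  by move=> zr; rewrite lerD2l ge0_ler_powR ?nnegrE.
set K := C1 * (1 + r `^ m) * Bm_norm m phi.
have K0 : 0 <= K by rewrite !mulr_ge0 // addr_ge0 // powR_ge0.
have wK z p : `|z| <= r -> 0 <= p -> C1 * p * weight m z * Bm_norm m phi <= p * K.
  move=> zr p0.
  have -> : p * K = C1 * p * (1 + r `^ m) * Bm_norm m phi by rewrite /K; ring.
  by rewrite ler_wpM2r // ler_wpM2l ?mulr_ge0 // wr.
have g1 z : `|z| <= r -> `|grad (P t s phi) z| <= (s - t) `^ (- gamma) * K.
  by move=> zr; apply: (le_trans (est z).1); rewrite wK // powR_ge0.
have g2 z : `|z| <= r -> op_norm (hess (P t s phi) z) <= (s - t) `^ (- (2 * gamma)) * K.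
  by move=> zr; apply: (le_trans (est z).2); rewrite wK // powR_ge0.
have vA : `|grad (P t s phi) x - grad (P t s phi) y| <= 2 * ((s - t) `^ (- gamma) * K).
  by apply: (le_trans (ler_normB _ _)); rewrite mulr_natl mulr2n lerD // g1.
have vD := grad_lipschitz_on_ball _ _ _ C2 g2 _ _ xr yr.
have b01 : 0 <= beta <= 1 by rewrite !ltW.
apply: (le_trans (interpolation_le _ _ _ _ (normr_ge0 _) b01 vA vD)).
set p1 := (s - t) `^ (- gamma); set p2 := (s - t) `^ (- (2 * gamma)).
have [p10 p20] : 0 <= p1 /\ 0 <= p2 by rewrite !powR_ge0.
rewrite (powRM (1 - beta) (ler0n _ 2) (mulr_ge0 p10 K0)) (powRM (1 - beta) p10 K0).
rewrite (powRM beta (mulr_ge0 p20 K0) (normr_ge0 _)) (powRM beta p20 K0).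
rewrite /p1 /p2 -!powRrM.
rewrite le_eqVlt; apply/orP; left; apply/eqP.
have -> : 2 `^ (1 - beta) * C1 * (1 + r `^ m) * (s - t) `^ (- (gamma * (1 + beta)))
    * Bm_norm m phi * `|x - y| `^ beta =
    2 `^ (1 - beta) * (s - t) `^ (- (gamma * (1 + beta))) * K * `|x - y| `^ beta.
  by rewrite /K; ring.
have {3}-> : K = K `^ (1 - beta) * K `^ beta.
  by rewrite -powRD subrK ?powRr1 // oner_eq0.
have -> : - (gamma * (1 + beta)) = - gamma * (1 - beta) + - (2 * gamma) * beta.
  by ring.
rewrite [(s - t) `^ (_ + _)]powRD; last by rewrite (gt_eqF st) implybT.
ring.
Qed.

End MeanValue.

(** * The singular time kernel *)

Section SingularKernel.
Context {R : realType}.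

Lemma is_derive_shifted_powR (t p s : R) : t < s ->
  is_derive s 1 (fun r : R => (r - t) `^ p) (p * (s - t) `^ (p - 1)).
Proof.
move=> ts; have st : 0 < s - t by rewrite subr_gt0.
have dg : is_derive (s : R) 1 ((fun r : R => r - t) : R -> R) 1.
  by apply: is_derive_eq; rewrite subr0.
have := @is_derive1_comp R (fun y => y `^ p) (fun r => r - t) s _ _
  (is_derive1_powR _ st) dg.
by rewrite mulr1.
Qed.

Lemma measurable_shifted_powR (t p : R) :
  measurable_fun setT (fun s : R => ((s - t) `^ p)%:E).
Proof.
apply/measurable_EFinP.
apply: (@measurableT_comp _ _ _ _ _ _ (fun y : R => y `^ p) _ (fun s : R => s - t)).
  exact: measurable_powR.
exact: measurable_funB.
Qed.

(** The interval is exhausted by compact ones that stay away from the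
    singularity at [t]; on these the fundamental theorem of calculus applies to
    the primitive [G]. *)
Lemma integral_powR_singular (t T a : R) : t < T -> a < 1 ->
  (\int[lebesgue_measure]_(s in `]t, T]) ((s - t) `^ (- a))%:E <=
     ((T - t) `^ (1 - a) / (1 - a))%:E)%E.
Proof.
move=> tT a1; have Tt : 0 < T - t by rewrite subr_gt0.
have a1' : 0 < 1 - a by rewrite subr_gt0.
pose G (s : R) : R := (1 - a)^-1 * (s - t) `^ (1 - a).
pose tn (n : nat) : R := t + (T - t) / n.+2%:R.
have tn_gt n : t < tn n by rewrite ltrDl divr_gt0.
have tn_lt n : tn n < T.
  by rewrite -ltrBrDl ltr_pdivrMr // ltr_pMr // ltr1n.
have dG (s : R) : t < s -> is_derive s 1 G ((s - t) `^ (- a)).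
  move=> ts; have dp := is_derive_shifted_powR t (1 - a) s ts.
  have := is_deriveZ (1 - a)^-1 dp; congr (is_derive _ _ _ _).
  rewrite /GRing.scale /= mulKf ?gt_eqF //; congr (_ `^ _); ring.
have df (s : R) : t < s -> derivable (fun r : R => (r - t) `^ (- a)) s 1.
  by move=> ts; have [] := is_derive_shifted_powR t (- a) s ts.
have Gc (s : R) : t < s -> {for s, continuous G}.
  move=> ts; apply/differentiable_continuous/derivable1_diffP.
  by have [] := dG s ts.
have intn n : (\int[lebesgue_measure]_(s in `[tn n, T]) ((s - t) `^ (- a))%:E =
    (G T)%:E - (G (tn n))%:E)%E.
  apply: (@continuous_FTC2 _ _ G) => //.
  - apply: derivable_within_continuous => s; rewrite in_itv /= => /andP[ns _].
    exact/df/(lt_le_trans (tn_gt n)).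
  - split.
    + move=> s; rewrite in_itv /= => /andP[ns _].
      by have [] := dG s (lt_trans (tn_gt n) ns).
    + by apply: cvg_at_right_filter; exact: Gc.
    + by apply: cvg_at_left_filter; exact: Gc.
  - move=> s; rewrite in_itv /= => /andP[ns _]; rewrite derive1E.
    by have [] := dG s (lt_trans (tn_gt n) ns).
have -> : `]t, T]%classic = \bigcup_n `[tn n, T]%classic.
  apply/seteqP; split=> s /=; rewrite in_itv /=; last first.
    by move=> [n _]; rewrite /= in_itv /= => /andP[/(lt_le_trans (tn_gt n)) -> ->].
  move=> /andP[ts sT].
  have : \forall n \near \oo, (T - t)^-1 * (s - t) > n.+1%:R^-1.
    apply: (near_infty_natSinv_lt (PosNum _)).
    by rewrite mulr_gt0 ?invr_gt0 // subr_gt0.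
  case=> N _ /(_ N (leqnn N)) /= NS; exists N => //=; rewrite in_itv /= sT andbT.
  rewrite -lerBrDl mulrC -ler_pdivlMr // mulrC; apply: le_trans (ltW NS).
  by rewrite lef_pV2 ?posrE // ler_nat.
have mono : nondecreasing_seq (fun n => `[tn n, T]%classic).
  move=> i j ij; rewrite subsetEset => s /=; rewrite !in_itv /= => /andP[si ->].
  rewrite andbT (le_trans _ si) // lerD2l ler_pM2l // lef_pV2 ?posrE //.
  by rewrite ler_nat !ltnS.
have cvgn : (\int[lebesgue_measure]_(s in `[tn n, T]) ((s - t) `^ (- a))%:E)%E
    @[n --> \oo] -->
    (\int[lebesgue_measure]_(s in \bigcup_n `[tn n, T]%classic)
      ((s - t) `^ (- a))%:E)%E.
  apply: ge0_nondecreasing_set_cvg_integral => //.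
  - by move=> n; apply: measurable_funTS; exact: measurable_shifted_powR.
  - by move=> n s _; rewrite lee_fin powR_ge0.
rewrite -(cvg_lim _ cvgn) //; apply: lime_le; first exact: cvgP cvgn.
apply: nearW => n; rewrite intn -EFinB lee_fin /G mulrC lerBlDr lerDl.
by rewrite mulr_ge0 ?powR_ge0 // invr_ge0 ltW.
Qed.

Lemma integrable_powR_singular (t T a : R) : t < T -> a < 1 ->
  lebesgue_measure.-integrable `]t, T] (fun s => ((s - t) `^ (- a))%:E).
Proof.
move=> tT a1; apply/integrableP; split.
  by apply: measurable_funTS; exact: measurable_shifted_powR.
under eq_integral do rewrite gee0_abs ?lee_fin ?powR_ge0 //.
exact: le_lt_trans (integral_powR_singular _ _ _ tT a1) (ltry _).
Qed.

Lemma Rintegral_powR_singular (t T a : R) : t < T -> a < 1 ->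
  \int[lebesgue_measure]_(s in `]t, T]) ((s - t) `^ (- a)) <=
     (T - t) `^ (1 - a) / (1 - a).
Proof.
move=> tT a1; rewrite -lee_fin fineK; first exact: integral_powR_singular.
by apply: integrable_fin_num => //; exact: integrable_powR_singular.
Qed.

End SingularKernel.

(** * Differentiation under the integral sign *)

Section IntegralGradient.
Context {R : realType} {H : hilbertType R} {d : measure_display}
  {S : measurableType d} (mu : {measure set S -> \bar R}) (D : set S).
Hypothesis mD : measurable D.
Implicit Types (x y z g h : H).

Lemma Rintegral_dominated (f k : S -> R) : measurable_fun D f ->
  mu.-integrable D (EFin \o k) -> (forall s, D s -> `|f s| <= k s) ->
  mu.-integrable D (EFin \o f) /\
  `|\int[mu]_(s in D) f s| <= \int[mu]_(s in D) k s.
Proof.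
move=> mf ik fk.
have if_ : mu.-integrable D (EFin \o f).
  apply: (le_integrable mD _ _ ik); first exact/measurable_EFinP.
  move=> s Ds /=; rewrite lee_fin; apply: (le_trans (fk s Ds)); exact: ler_norm.
split => //; apply: (le_trans (le_normr_Rintegral _ _)) => //.
by apply: le_Rintegral => //; exact: integrable_norm.
Qed.

Lemma holder_small (C beta : R) x (e : R) : 0 <= C -> 0 < beta -> 0 < e ->
  \forall y \near x, C * `|y - x| `^ beta <= e.
Proof.
move=> C0 b0 e0; have C1 : 0 < C + 1 by rewrite ltr_wpDl.
have eC : 0 < e / (C + 1) by rewrite divr_gt0.
near=> y; have : `|y - x| `^ beta <= e / (C + 1).
  have -> : e / (C + 1) = ((e / (C + 1)) `^ beta^-1) `^ beta.
    by rewrite -powRrM mulVf ?gt_eqF // powRr1 // ltW.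
  apply: ge0_ler_powR; rewrite ?nnegrE ?powR_ge0 // ?(ltW b0) //.
  rewrite distrC; near: y.
  by apply: cvgr_dist_le; [exact: cvg_id|exact: powR_gt0].
rewrite ler_pdivlMr //; apply: le_trans; rewrite mulrC ler_wpM2l ?powR_ge0 //.
by rewrite lerDl.
Unshelve. all: by end_near. Qed.

Context (F : S -> H -> R).
Hypothesis dF : forall s, D s -> forall z, differentiable (F s : H -> R^o) z.
Hypothesis iF : forall z, mu.-integrable D (fun s => (F s z)%:E).
Context (a : S -> R) (w : H -> R).
Hypothesis ia : mu.-integrable D (EFin \o a).
Hypothesis gF : forall s, D s -> forall z, `|grad (F s) z| <= a s * w z.

Let V z := \int[mu]_(s in D) F s z.

Let mF y : measurable_fun D (fun s => F s y).
Proof. by apply/measurable_EFinP; case/integrableP : (iF y). Qed.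

(** A directional derivative is a limit of difference quotients, which inherit
    measurability in [s] from the family. *)
Lemma measurable_grad_inner z h :
  measurable_fun D (fun s => inner (grad (F s) z) h).
Proof.
apply: (@measurable_fun_cvg _ _ _ _
  (fun n s => n.+1%:R * (F s (z + n.+1%:R^-1 *: h) - F s z))).
  by move=> n; apply: measurable_funM => //; exact: measurable_funB.
move=> s Ds; apply/cvgrPdist_le => e e0.
have e1 : 0 < e / (`|h| + 1) by rewrite divr_gt0 // ltr_wpDl.
have := differentiable_has_grad _ _ (dF s Ds z) _ e1.
have hn : z + (n.+1%:R^-1 : R) *: h @[n --> \oo] --> z.
  have := cvgD (cvg_cst z) (cvgZr_tmp (a := h) (@cvg_harmonic R)).
  by rewrite scale0r addr0; apply.
move=> hg; apply: (@filterS _ \oo _ _ _ _ (hn _ hg)) => n /=.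
rewrite [z + _ - z]addrAC subrr add0r innerZr normrZ.
set N : R := n.+1%:R; have N0 : 0 < N by rewrite ltr0n.
set D1 := F s _ - F s z; set ip := inner _ _ => le1; clearbody D1 ip.
have -> : ip - N * D1 = - (N * (D1 - N^-1 * ip)).
  by rewrite mulrBr mulVKf ?gt_eqF // opprB.
rewrite normrN normrM (gtr0_norm N0) -ler_pdivlMl //; apply: (le_trans le1).
rewrite (@gtr0_norm _ N^-1) ?invr_gt0 // mulrCA ler_pM2l ?invr_gt0 //.
by rewrite mulrAC ler_pdivrMr ?ltr_wpDl // ler_pM2l // lerDl.
Qed.

Lemma integrable_grad_inner z h :
  mu.-integrable D (fun s => (inner (grad (F s) z) h)%:E) /\
  `|\int[mu]_(s in D) inner (grad (F s) z) h| <= (\int[mu]_(s in D) a s) * w z * `|h|.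
Proof.
have ia' : mu.-integrable D (EFin \o (fun s => a s * (w z * `|h|))).
  exact: (integrableZr mD (w z * `|h|) ia).
have [|i1 i2] := Rintegral_dominated _ _ (measurable_grad_inner z h) ia'.
  move=> s Ds; apply: (le_trans (cauchy_schwarz _ _)).
  by rewrite mulrA ler_wpM2r // gF.
by split => //; apply: (le_trans i2); rewrite RintegralZr // mulrA.
Qed.

Context (k : S -> R) (c : R -> R) (beta0 : R).
Hypothesis b0 : 0 < beta0.
Hypothesis ik : mu.-integrable D (EFin \o k).
Hypothesis k0 : forall s, D s -> 0 <= k s.
Hypothesis c0 : forall r, 0 <= r -> 0 <= c r.
Hypothesis hF : forall s, D s -> forall r x y, `|x| <= r -> `|y| <= r ->
  `|grad (F s) x - grad (F s) y| <= c r * k s * `|x - y| `^ beta0.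

(** The integral of the directional derivatives is a bounded functional of the
    direction, hence represented by a vector. The first-order remainders are
    bounded by [|y - z|^(1 + beta0)] times an integrable function of [s], so that
    this vector is a Frechet gradient: the Holder bound replaces a dominated
    convergence argument. *)
Lemma has_grad_integral z :
  differentiable (V : H -> R^o) z /\
  forall h, inner (grad V z) h = \int[mu]_(s in D) inner (grad (F s) z) h.
Proof.
have iG x h := (integrable_grad_inner x h).1.
have [al x y|h|g gE] := @riesz _ _ (fun h => \int[mu]_(s in D) inner (grad (F s) z) h)
    ((\int[mu]_(s in D) a s) * w z).
- rewrite -(RintegralZl al mD (iG z x)).
  rewrite -(RintegralD mD (integrableZl mD al (iG z x)) (iG z y)).
  by apply: eq_Rintegral => s _; rewrite innerDr innerZr.
- exact: (integrable_grad_inner z h).2.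
suff hg : has_grad V z g.
  by have [dV ->] := has_gradP _ _ _ hg; split => // h; rewrite gE.
move=> e e0; pose r := `|z| + 1.
have C0 : 0 <= c r * \int[mu]_(s in D) k s.
  by rewrite mulr_ge0 ?c0 ?addr_ge0 //; exact: Rintegral_ge0.
near=> y.
have yz : `|y - z| <= 1.
  by rewrite distrC; near: y; apply: cvgr_dist_le; [exact: cvg_id|].
have zr : `|z| <= r by rewrite lerDl.
have yr : `|y| <= r.
  by rewrite -(subrK z y) addrC (le_trans (ler_normD _ _)) // lerD2l.
pose rem s := F s y - F s z - inner (grad (F s) z) (y - z).
have -> : V y - V z - inner g (y - z) = \int[mu]_(s in D) rem s.
  rewrite (RintegralB mD (integrableB mD (iF y) (iF z)) (iG z (y - z))).
  by rewrite (RintegralB mD (iF y) (iF z)) gE.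
set q := `|y - z| `^ beta0 * `|y - z|.
have mrem : measurable_fun D rem.
  apply: measurable_funB; last exact: measurable_grad_inner.
  by apply: measurable_funB; exact: mF.
have lerem s : D s -> `|rem s| <= k s * (c r * q).
  move=> Ds; have -> : k s * (c r * q) = c r * k s * `|y - z| `^ beta0 * `|y - z|.
    by rewrite /q; ring.
  apply: (@remainder_on_ball _ _ _ r) => //; [|exact: ltW|exact: dF|exact: hF].
  by rewrite mulr_ge0 ?c0 ?k0 // addr_ge0.
have [_ /le_trans] := Rintegral_dominated _ _ mrem (integrableZr mD (c r * q) ik) lerem.
apply.
have -> : \int[mu]_(s in D) (k s * (c r * q)) =
    c r * (\int[mu]_(s in D) k s) * `|y - z| `^ beta0 * `|y - z|.
  by rewrite RintegralZr // /q; ring.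
rewrite ler_wpM2r //; near: y; exact: holder_small.
Unshelve. all: by end_near. Qed.

Lemma grad_integral_bound z : `|grad V z| <= (\int[mu]_(s in D) a s) * w z.
Proof.
apply: norm_le_dual => [|h].
  rewrite -RintegralZr //; apply: Rintegral_ge0 => s Ds.
  exact: le_trans (gF s Ds z).
rewrite (has_grad_integral z).2; apply: (le_trans (ler_norm _)).
exact: (integrable_grad_inner z h).2.
Qed.

Lemma grad_integral_increment (l : S -> R) (q : R) x y :
  mu.-integrable D (EFin \o l) ->
  (forall s, D s -> `|grad (F s) x - grad (F s) y| <= l s * q) ->
  `|grad V x - grad V y| <= (\int[mu]_(s in D) l s) * q.
Proof.
move=> il hl; apply: norm_le_dual => [|h].
  rewrite -RintegralZr //; apply: Rintegral_ge0 => s Ds.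
  exact: le_trans (hl s Ds).
rewrite innerBl (has_grad_integral x).2 (has_grad_integral y).2.
rewrite -(RintegralB mD (integrable_grad_inner x h).1 (integrable_grad_inner y h).1).
rewrite -mulrA -(RintegralZr (q * `|h|) mD il).
apply: (le_trans (ler_norm _)).
apply: (Rintegral_dominated _ _ _ (integrableZr mD (q * `|h|) il) _).2.
  by apply: measurable_funB; exact: measurable_grad_inner.
move=> s Ds; rewrite -innerBl; apply: (le_trans (cauchy_schwarz _ _)).
by rewrite mulrA ler_wpM2r // hl.
Qed.

Lemma frechet_C1_integral : frechet_C1 V.
Proof.
split=> z; first exact: (has_grad_integral z).1.
apply/cvgrPdist_le => e e0; pose r := `|z| + 1.
have r0 : 0 <= r by rewrite addr_ge0.
have C0 : 0 <= (\int[mu]_(s in D) k s) * c r.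
  by rewrite mulr_ge0 ?c0 //; exact: Rintegral_ge0.
near=> y; rewrite distrC.
have yz : `|y - z| <= 1.
  by rewrite distrC; near: y; apply: cvgr_dist_le; [exact: cvg_id|].
have yr : `|y| <= r.
  by rewrite -(subrK z y) addrC (le_trans (ler_normD _ _)) // lerD2l.
apply: (le_trans (grad_integral_increment k (c r * `|y - z| `^ beta0) _ _ ik _)).
  by move=> s Ds; rewrite mulrA (mulrC (k s)) hF // lerDl.
by rewrite mulrA; near: y; exact: holder_small.
Unshelve. all: by end_near. Qed.

End IntegralGradient.

(** * Joint measurability of a continuous process *)

Section BorelLimits.
Context {R : realType} {V : normedModType R} {d : measure_display}
  {S : measurableType d}.

Lemma open_borel (O : set V) : open O -> measurable (O : set (borel V)).
Proof. by move=> oO; exact: sub_sigma_algebra. Qed.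

Lemma closed_borel (C : set V) : closed C -> measurable (C : set (borel V)).
Proof.
move=> cC; have oC : open (~` C) by rewrite openC.
by have := measurableC (open_borel _ oC); rewrite setCK.
Qed.

Lemma borel_map_of_open (f : S -> borel V) :
  (forall O : set V, open O -> measurable (f @^-1` O)) -> measurable_fun setT f.
Proof.
move=> fO; apply: (@measurability _ _ _ _ setT f (@open V)) => //.
by move=> _ [G oG <-]; rewrite setTI; exact: fO.
Qed.

(** The set [core j] is an open part of [O] from which balls of radius
    [1/(j+1)] do not leave [O]. A limit lies in [O] iff for some [j] the sequence
    eventually stays in [core j], which is a countable condition. *)
Lemma measurable_borel_cvg (Y : nat -> S -> borel V) (Z : S -> borel V) :
  (forall n, measurable_fun setT (Y n)) ->
  (forall s, (Y ^~ s : nat -> V) @ \oo --> (Z s : V)) -> measurable_fun setT Z.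
Proof.
move=> mY YZ; apply: borel_map_of_open => O oO.
pose core (j : nat) : set V := interior [set z | ball z (j.+1%:R^-1 : R) `<=` O].
have -> : Z @^-1` O =
    \bigcup_j \bigcup_N \bigcap_(n in [set n | (N <= n)%N]) (Y n @^-1` core j).
  apply/seteqP; split=> s /=.
    move=> Os; have /nbhs_ballP[e /= e0 eO] : nbhs (Z s : V) O by exact: open_nbhs_nbhs.
    have [j _ /(_ j (leqnn _)) /= je] : \forall j \near \oo, (j.+1%:R^-1 : R) < e / 2.
      by apply: (near_infty_natSinv_lt (PosNum _)); rewrite divr_gt0.
    have Zj : nbhs (Z s : V) (core j).
      apply: nbhs_interior; apply/nbhs_ballP.
      exists (e / 2); first by rewrite /= divr_gt0.
      move=> y Zy z yz; apply: eO; rewrite (splitr e); apply: ball_triangle Zy _.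
      by apply: le_ball yz; exact: ltW.
    have [N _ NY] := YZ s _ Zj.
    by exists j => //; exists N => // n /= Nn; exact: NY.
  move=> [j _ [N _ NY]].
  have /nbhs_ballP : nbhs (Z s : V) (ball (Z s : V) (j.+1%:R^-1 : R)).
    by apply: nbhsx_ballx; rewrite invr_gt0.
  move=> /nbhs_ballP/(YZ s)[M _ MY].
  have /interior_subset := NY (maxn N M) (leq_maxl _ _).
  by apply; apply: ball_sym; apply: MY => /=; exact: leq_maxr.
apply: bigcupT_measurable => j; apply: bigcupT_measurable => N.
apply: bigcap_measurable; first by exists N => /=.
move=> n _; rewrite -[X in measurable X]setTI; apply: mY => //.
by apply: open_borel; exact: open_interior.
Qed.

End BorelLimits.

Section ProductTopology.
Context {R : realType} {H : hilbertType R}.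

Lemma pair_continuous (c : R) : continuous (fun z : H => (c, z) : (R * H)%type).
Proof. by move=> z; exact: (cvg_pair (cvg_cst c) cvg_id). Qed.

Lemma open_section (c : R) (G : set (R * H)) : open G -> open [set z | G (c, z)].
Proof. by move=> oG; apply: (open_comp _ oG) => z _; exact: pair_continuous. Qed.

Lemma closed_strip (T : R) : closed (strip H T).
Proof.
have -> : strip H T = (@fst R H) @^-1` `[0, T].
  by apply/seteqP; split=> p; rewrite /strip /= in_itv.
apply: closed_comp => [[x z] _|]; last exact: interval_closed.
exact: (@cvg_fst _ _ (nbhs x) (nbhs z)).
Qed.

End ProductTopology.

Section MeasurableExpectation.
Context {R : realType} {H : hilbertType R} {d : measure_display}
  {Omega : measurableType d} (P : probability Omega R).
Context (t T : R) (Z : R -> Omega -> H).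
Hypothesis tT : t <= T.
Hypothesis mZ : forall s, t <= s <= T ->
  measurable_fun setT (Z s : Omega -> borel H).
Hypothesis cZ : forall w, {within `[t, T], continuous (fun s => Z s w)}.

(** Freezing time outside [[t, T]] turns the state into a process with
    continuous paths on the whole line. *)
Definition clamp (s : R) : R := Num.min T (Num.max t s).

Lemma clamp_itv s : t <= clamp s <= T.
Proof. by rewrite /clamp ge_min lexx orTb le_min tT le_max lexx. Qed.

Lemma clamp_id s : t <= s <= T -> clamp s = s.
Proof. by move=> /andP[ts sT]; rewrite /clamp max_r // min_r. Qed.

Let cell (n : nat) (s : R) : R := (clamp s - t) * n.+1%:R.
Let node (n k : nat) : R := t + k%:R / n.+1%:R.
Let grid (n : nat) (s : R) : R := node n (Num.truncn (cell n s)).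

Let cell_ge0 n s : 0 <= cell n s.
Proof. by rewrite mulr_ge0 // subr_ge0; case/andP: (clamp_itv s). Qed.

Let grid_itv n s : t <= grid n s <= clamp s.
Proof.
rewrite lerDl divr_ge0 //= -lerBrDl ler_pdivrMr ?ltr0n //.
by have /andP[] := truncn_itv (cell_ge0 n s).
Qed.

Let grid_near n s : clamp s - grid n s <= n.+1%:R^-1.
Proof.
have /andP[_ /ltW] := truncn_itv (cell_ge0 n s).
rewrite /grid /node; set k := Num.truncn _.
rewrite /cell -ler_pdivlMr ?ltr0n // -[k.+1%:R]natr1 mulrDl mul1r.
by move: (k%:R / n.+1%:R : R) (n.+1%:R^-1 : R) => p q; lra.
Qed.

Let measurable_cell n k : measurable [set s : R | Num.truncn (cell n s) = k].
Proof.
have mc : measurable_fun setT (cell n).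
  apply: measurable_funM => //; apply: measurable_funB => //.
  by apply: measurable_minr => //; exact: measurable_maxr.
have -> : [set s : R | Num.truncn (cell n s) = k] =
    setT `&` cell n @^-1` `[(k%:R : R), k.+1%:R[.
  apply/seteqP; split=> s /=; rewrite in_itv /=.
    by move=> <-; split => //; exact: truncn_itv.
  by move=> [_ ks]; exact: truncn_def.
exact: mc.
Qed.

(** Sampling the paths on the grid of mesh [1/(n+1)] gives a countable patchwork
    of measurable maps; continuity of the paths takes care of the limit. *)
Lemma measurable_time_state : measurable_fun setT
  ((fun p => (clamp p.1, Z (clamp p.1) p.2)) :
     (R * Omega)%type -> borel (R * H)%type).
Proof.
pose Y (n : nat) (p : (R * Omega)%type) : borel (R * H)%type :=
  (grid n p.1, Z (grid n p.1) p.2).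
apply: (@measurable_borel_cvg _ (R * H)%type _ _ Y).
  move=> n; apply: borel_map_of_open => O oO.
  have -> : Y n @^-1` O = \bigcup_k ([set s : R | Num.truncn (cell n s) = k] `*`
      [set w | O (node n k, Z (node n k) w)]).
    apply/seteqP; split=> p /=; first by move=> Op; exists (Num.truncn (cell n p.1)).
    by move=> [k _ [/= <-]].
  apply: bigcupT_measurable => k.
  have [kT|kT] := leP (node n k) T; last first.
    rewrite [X in X `*` _](_ : _ = set0) ?set0X //.
    apply/seteqP; split=> // s /= sk.
    have /andP[_ gs] := grid_itv n s; have /andP[_ cs] := clamp_itv s.
    by move: kT; rewrite -sk ltNge (le_trans gs).
  apply: measurableX; first exact: measurable_cell.
  have oOk : open [set z : H | O (node n k, z)] by exact: open_section.
  have nk : t <= node n k <= T by rewrite kT andbT lerDl divr_ge0.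
  by have := mZ _ nk measurableT _ (open_borel _ oOk); rewrite setTI.
move=> [s w] /=.
have gc : grid ^~ s @ \oo --> clamp s.
  apply/cvgrPdist_le => e e0.
  have := near_infty_natSinv_lt (PosNum e0); apply: filterS => n /= ne.
  have /andP[_ gs] := grid_itv n s.
  by rewrite ger0_norm ?subr_ge0 // (le_trans (grid_near n s)) // ltW.
suff Zgc : (fun n => Z (grid n s) w) @ \oo --> Z (clamp s) w.
  exact: (cvg_pair gc Zgc).
have : Z ^~ w @ within `[t, T] (nbhs (clamp s)) --> Z (clamp s) w.
  by have /subspace_continuousP := cZ w; apply; rewrite /= in_itv /= clamp_itv.
move=> Zc; apply: (cvg_comp _ _ _ Zc) => A; rewrite /within /= => nA.
apply: (@filterS _ \oo _ _ _ _ (gc _ nA)) => n /=; apply.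
rewrite in_itv /=; have /andP[-> gs] := grid_itv n s.
by have /andP[_ cs] := clamp_itv s; rewrite (le_trans gs).
Qed.

(** The positive and negative parts are treated separately by Tonelli's theorem,
    and [fine] is Borel, so that times with an infinite expectation do no harm. *)
Lemma measurable_expectation (g : R -> H -> R) : 0 <= t ->
  borel_map (R * H)%type (strip H T) (fun p => g p.1 p.2) ->
  measurable_fun `]t, T] (fun s => fine 'E_P[fun w => g s (Z s w)]).
Proof.
move=> t0 mg.
pose G (p : (R * Omega)%type) : R := g (clamp p.1) (Z (clamp p.1) p.2).
have mG : measurable_fun setT G.
  apply: (@measurable_comp _ _ _ (R * Omega)%type (borel (R * H)%type) _
    (strip H T) (fun p => g p.1 p.2) setT
    (fun p => (clamp p.1, Z (clamp p.1) p.2))) => //.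
  - exact: (@closed_borel _ (R * H)%type _ (@closed_strip R H T)).
  - move=> _ [[s w] _ <-] /=; have /andP[ts sT] := clamp_itv s.
    by apply/andP; split=> //; exact: le_trans ts.
  - exact: measurable_time_state.
have mE (h : (R * Omega)%type -> R) : measurable_fun setT h -> measurable_fun setT
    (fun s => \int[P]_w (h (s, w))%:E)%E.
  move=> /measurable_EFinP mh.
  have mp := @measurable_fun_fubini_tonelli_F _ _ _ _ _ P _ (measurable_funepos mh)
    (fun=> funepos_ge0 _ _).
  have mn := @measurable_fun_fubini_tonelli_F _ _ _ _ _ P _ (measurable_funeneg mh)
    (fun=> funeneg_ge0 _ _).
  apply: eq_measurable_fun (emeasurable_funB mp mn) => s _.
  rewrite [RHS]integralE /fubini_F; congr (_ - _)%E; apply: eq_integral => w _.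
    by rewrite !funeposE.
  by rewrite !funenegE.
have mf : measurable_fun setT (fun s => fine 'E_P[fun w => G (s, w)]).
  apply: (@measurableT_comp _ _ _ _ _ _ (@fine R)) => //.
  by rewrite unlock; exact: mE.
apply: (@eq_measurable_fun _ _ _ _ _ (fun s => fine 'E_P[fun w => G (s, w)])).
  move=> s; rewrite inE /= in_itv /= => /andP[/ltW ts sT].
  by rewrite /G /= clamp_id // ts.
exact: measurable_funTS.
Qed.

End MeasurableExpectation.

(** * The integral term of the mild equation *)

Section DuhamelTerm.
Context {R : realType} {H : hilbertType R}.
Implicit Types (x y z : H).

Lemma frechet_C1_cst0 : frechet_C1 (fun _ : H => 0 : R) /\
  forall x, grad (fun _ : H => 0 : R) x = 0.
Proof.
have h0 x : has_grad (fun _ : H => 0 : R) x 0.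
  by move=> e e0; near=> y; rewrite inner0l !subr0 normr0 mulr_ge0 // ltW.
have g0 x := has_gradP _ _ _ (h0 x).
split=> [|x]; last exact: (g0 x).2.
split=> x; first exact: (g0 x).1.
rewrite (_ : grad _ = fun=> 0); first exact: cvg_cst.
by apply/funext => y; exact: (g0 y).2.
Unshelve. all: by end_near. Qed.

Lemma gradD (phi psi : H -> R) x :
  differentiable (phi : H -> R^o) x -> differentiable (psi : H -> R^o) x ->
  grad (phi \+ psi) x = grad phi x + grad psi x.
Proof.
move=> dphi dpsi; apply: (has_gradP _ _ _ _).2.
by apply: has_gradD; exact: differentiable_has_grad.
Qed.

Lemma frechet_C1D (phi psi : H -> R) :
  frechet_C1 phi -> frechet_C1 psi -> frechet_C1 (phi \+ psi).
Proof.
move=> [dphi cphi] [dpsi cpsi]; split=> x.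
  apply: (has_gradP _ _ _ _).1; last first.
    by apply: has_gradD; exact: differentiable_has_grad.
rewrite (_ : grad (phi \+ psi) = grad phi \+ grad psi).
  by apply: continuousD; [exact: cphi|exact: cpsi].
by apply/funext => y; exact: gradD.
Qed.

(** The real-valued integral of a measurable function that fails to be
    integrable is an infinite integral truncated to [0]. *)
Lemma Rintegral_not_integrable {d : measure_display} {S : measurableType d}
    (mu : {measure set S -> \bar R}) (D : set S) (f : S -> R) : measurable D ->
  measurable_fun D f -> ~ mu.-integrable D (EFin \o f) ->
  \int[mu]_(s in D) f s = 0.
Proof.
move=> mD mf nf; have mEf : measurable_fun D (EFin \o f) by exact/measurable_EFinP.
rewrite /Rintegral; have := @integral_fin_num_abs _ _ _ mu _ _ mD mf.
case: (\int[mu]_(s in D) (f s)%:E)%E => //= r fin.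
by case: nf; apply/integrableP; split => //; rewrite fin.
Qed.

Context (m T C1 gamma : R) (P : R -> R -> (H -> R) -> H -> R).
Hypothesis (m0 : 0 <= m) (C0 : 0 < C1) (g01 : 0 < gamma < 1).
Hypothesis hP : smoothing m T P C1 gamma.
Context (t N : R) (f : R -> H -> R).
Hypothesis (t0 : 0 <= t) (tT : t < T).
Hypothesis fB : forall s, t < s <= T -> Bm m (f s) /\ Bm_norm m (f s) <= N.
Hypothesis mf : forall x,
  measurable_fun `]t, T] (fun s => P t s (f s) x).

Let V x := \int[lebesgue_measure]_(s in `[t, T]) P t s (f s) x.
Let kernel_mass (a : R) : R := (T - t) `^ (1 - a) / (1 - a).

Lemma Bm_norm_ge0 (phi : H -> R) : Bm m phi -> 0 <= Bm_norm m phi.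
Proof.
move=> Bphi; apply: le_trans (ub_le_sup Bphi.2 _); last by exists 0.
by rewrite divr_ge0 // addr_ge0 // powR_ge0.
Qed.

Let N0 : 0 <= N.
Proof.
have [|fT1 fT2] := fB T; first by rewrite tT lexx.
exact: le_trans (Bm_norm_ge0 _ fT1) fT2.
Qed.

Let VE x : V x = \int[lebesgue_measure]_(s in `]t, T]) P t s (f s) x.
Proof.
rewrite /V /Rintegral -integral_itv_obnd_cbnd //.
exact/measurable_EFinP.
Qed.

Let grad_le s x : t < s <= T ->
  `|grad (P t s (f s)) x| <= C1 * N * (s - t) `^ (- gamma) * weight m x.
Proof.
move=> /[dup] sT /andP[ts sT']; have [fs1 fs2] := fB s sT.
apply: (le_trans ((hP t s (f s) t0 ts sT' fs1).2 x).1).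
have -> : C1 * N * (s - t) `^ (- gamma) * weight m x =
  C1 * (s - t) `^ (- gamma) * weight m x * N by ring.
by rewrite ler_wpM2l // !mulr_ge0 ?powR_ge0 ?(ltW C0) // addr_ge0 ?powR_ge0.
Qed.

Let grad_holder s (r beta : R) x y : t < s <= T -> 0 < beta < 1 ->
  `|x| <= r -> `|y| <= r ->
  `|grad (P t s (f s)) x - grad (P t s (f s)) y| <=
  2 `^ (1 - beta) * C1 * (1 + r `^ m) * N * (s - t) `^ (- (gamma * (1 + beta)))
    * `|x - y| `^ beta.
Proof.
move=> /[dup] sT /andP[ts sT'] b01 xr yr; have [fs1 fs2] := fB s sT.
apply: (le_trans (smoothing_holder _ _ _ _ _ _ _ _ _ _
  m0 (ltW C0) hP t0 ts sT' fs1 b01 _ _ xr yr)).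
rewrite ler_wpM2r ?powR_ge0 //.
have -> : 2 `^ (1 - beta) * C1 * (1 + r `^ m) * N * (s - t) `^ (- (gamma * (1 + beta)))
  = 2 `^ (1 - beta) * C1 * (1 + r `^ m) * (s - t) `^ (- (gamma * (1 + beta))) * N by ring.
by rewrite ler_wpM2l // !mulr_ge0 ?powR_ge0 ?(ltW C0) // addr_ge0 ?powR_ge0.
Qed.

Let dF s : t < s <= T -> forall x, differentiable (P t s (f s) : H -> R^o) x.
Proof.
move=> /[dup] sT /andP[ts sT'] x.
by have [[[d _] _ _] _] := hP t s (f s) t0 ts sT' (fB s sT).1.
Qed.

Let integrable_kernel (a c : R) : a < 1 ->
  lebesgue_measure.-integrable `]t, T] (EFin \o (fun s => c * (s - t) `^ (- a))).
Proof.
by move=> a1; exact: (integrableZl _ c (integrable_powR_singular _ _ _ tT a1)).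
Qed.

Let Rintegral_kernel_le (a c : R) : 0 <= c -> a < 1 ->
  \int[lebesgue_measure]_(s in `]t, T]) (c * (s - t) `^ (- a)) <= c * kernel_mass a.
Proof.
move=> c0 a1; rewrite RintegralZl //; last exact: integrable_powR_singular.
by rewrite ler_wpM2l // Rintegral_powR_singular.
Qed.

Let integrable_everywhere x0 :
  lebesgue_measure.-integrable `]t, T] (fun s => (P t s (f s) x0)%:E) ->
  forall x, lebesgue_measure.-integrable `]t, T] (fun s => (P t s (f s) x)%:E).
Proof.
move=> i0 x; pose r := `|x0| + `|x|; case/andP: g01 => ga0 ga1.
pose D s := P t s (f s) x - P t s (f s) x0.
have [iD _] : lebesgue_measure.-integrable `]t, T] (EFin \o D) /\
    `|\int[lebesgue_measure]_(s in `]t, T]) D s| <=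
    \int[lebesgue_measure]_(s in `]t, T])
      (C1 * N * (1 + r `^ m) * `|x - x0| * (s - t) `^ (- gamma)).
  apply: Rintegral_dominated => //.
  - by apply: measurable_funB; exact: mf.
  - exact: integrable_kernel.
  - move=> s; rewrite /= in_itv /= => sT.
    have -> : C1 * N * (1 + r `^ m) * `|x - x0| * (s - t) `^ (- gamma) =
      C1 * N * (s - t) `^ (- gamma) * (1 + r `^ m) * `|x - x0| by ring.
    apply: (lipschitz_on_ball _ r); rewrite ?lerDl ?lerDr //; first exact: dF.
    move=> z zr; apply: (le_trans (grad_le s z sT)).
    rewrite ler_wpM2l ?mulr_ge0 ?powR_ge0 ?(ltW C0) //.
    by rewrite lerD2l ge0_ler_powR ?nnegrE // (le_trans _ zr).
rewrite (_ : (fun s => (P t s (f s) x)%:E) =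
  (EFin \o D) \+ (fun s => (P t s (f s) x0)%:E)); first exact: integrableD.
by apply/funext => s; rewrite /D /= -EFinD subrK.
Qed.

(** Either the integrand is integrable in time at every point, and one
    differentiates under the integral sign, or at no point, and the integral is
    the constant [0]: increments in [x] are always integrable. *)
Lemma duhamel_estimates :
  [/\ frechet_C1 V,
      forall x, `|grad V x| <= C1 * (N * kernel_mass gamma) * weight m x &
      forall r beta : R, 0 < beta < 1 -> gamma * (1 + beta) < 1 ->
      forall x y, `|x| <= r -> `|y| <= r ->
      `|grad V x - grad V y| <= 2 `^ (1 - beta) * C1 * (1 + r `^ m) *
        (N * kernel_mass (gamma * (1 + beta))) * `|x - y| `^ beta].
Proof.
case/andP: g01 => ga0 ga1.
have w0 x : 0 <= weight m x by rewrite addr_ge0 ?powR_ge0.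
have kernel_mass0 a : a < 1 -> 0 <= kernel_mass a.
  by move=> a1; rewrite divr_ge0 ?powR_ge0 // subr_ge0 ltW.
have cst0 (r beta : R) : 0 <= 2 `^ (1 - beta) * C1 * (1 + r `^ m).
  by rewrite !mulr_ge0 ?powR_ge0 ?(ltW C0) // addr_ge0 ?powR_ge0.
have [i0|ni0] := pselect (lebesgue_measure.-integrable `]t, T]
    (fun s => (P t s (f s) 0)%:E)); last first.
  have -> : V = fun=> 0.
    apply/funext => x; rewrite VE; apply: Rintegral_not_integrable => //.
      exact: mf.
    by move=> ix; apply: ni0; exact: (integrable_everywhere x).
  have [C1_0 grad0] := frechet_C1_cst0.
  split=> // [x|r beta b01 gb x y xr yr]; rewrite ?grad0 ?subrr normr0.
    by rewrite mulr_ge0 // mulr_ge0 ?(ltW C0) // mulr_ge0 ?kernel_mass0.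
  by rewrite mulr_ge0 ?powR_ge0 // mulr_ge0 // mulr_ge0 ?kernel_mass0.
have iF := integrable_everywhere _ i0.
rewrite (_ : V = fun x => \int[lebesgue_measure]_(s in `]t, T]) P t s (f s) x);
  last by apply/funext.
(* Any exponent in ]0, 1[ with [gamma * (1 + b0) < 1] would do. *)
pose b0 := (1 - gamma) / 2.
have b01 : 0 < b0 < 1 by apply/andP; split; rewrite /b0; lra.
have gb0 : gamma * (1 + b0) < 1 by rewrite /b0; nra.
pose D : set R := `]t, T]%classic; pose Fam (s : R) x := P t s (f s) x.
have mD : measurable D by exact: measurable_itv.
have itvP s : D s -> t < s <= T by rewrite /D /= in_itv.
have dFi s : D s -> forall z, differentiable (Fam s : H -> R^o) z.
  by move=> /itvP; exact: dF.
have ia := integrable_kernel gamma (C1 * N) ga1.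
have gFi s (si : D s) z := grad_le s z (itvP s si).
have ik := integrable_kernel (gamma * (1 + b0)) 1 gb0.
pose c (r : R) := 2 `^ (1 - b0) * C1 * (1 + r `^ m) * N.
have c0 r : 0 <= r -> 0 <= c r by move=> _; rewrite mulr_ge0.
have k0 s : D s -> 0 <= 1 * (s - t) `^ (- (gamma * (1 + b0))).
  by rewrite mul1r powR_ge0.
have hFi s : D s -> forall (r : R) x y, `|x| <= r -> `|y| <= r ->
    `|grad (P t s (f s)) x - grad (P t s (f s)) y| <=
    c r * (1 * (s - t) `^ (- (gamma * (1 + b0)))) * `|x - y| `^ b0.
  by move=> si r x y xr yr; rewrite mul1r /c; exact: grad_holder (itvP s si) _ _ _.
have b00 : 0 < b0 by case/andP: b01.
split.
- exact: (@frechet_C1_integral R H _ _ lebesgue_measure D mD Fam dFi iF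
    _ _ ia gFi _ c b0 b00 ik k0 c0 hFi).
- move=> x; apply: (le_trans (@grad_integral_bound R H _ _ lebesgue_measure D mD
    Fam dFi iF _ _ ia gFi _ c b0 b00 ik k0 c0 hFi x)).
  by rewrite ler_wpM2r // mulrA Rintegral_kernel_le // mulr_ge0 // ltW.
- move=> r beta bb gb x y xr yr.
  pose l s := 2 `^ (1 - beta) * C1 * (1 + r `^ m) * N *
    (s - t) `^ (- (gamma * (1 + beta))).
  have il : lebesgue_measure.-integrable D (EFin \o l) by exact: integrable_kernel.
  have hl s : D s -> `|grad (Fam s) x - grad (Fam s) y| <= l s * `|x - y| `^ beta.
    by move=> /itvP si; exact: grad_holder.
  apply: (le_trans (@grad_integral_increment R H _ _ lebesgue_measure D mD
    Fam dFi iF _ _ ia gFi _ c b0 b00 ik k0 c0 hFi l _ x y il hl)).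
  rewrite ler_wpM2r ?powR_ge0 // [leRHS]mulrA Rintegral_kernel_le // mulr_ge0 //.
Qed.

End DuhamelTerm.

(** * Weighted supremum norms *)

Section WeightedNorms.
Context {R : realType} {H : hilbertType R}.
Implicit Types (m T : R) (f g u Phi : R -> H -> R).

Lemma weight_gt0 m (x : H) : 0 < weight m x.
Proof. by rewrite ltr_wpDr // powR_ge0. Qed.

Lemma BmT_bound m T f s x : BmT m T f -> 0 <= s <= T ->
  `|f s x| / weight m x <= BmT_norm m T f.
Proof. by move=> [_ fb] sT; apply: ub_le_sup => //; exists (s, x). Qed.

Lemma ler_BmT_norm m T f B : 0 <= T ->
  (forall s x, 0 <= s <= T -> `|f s x| / weight m x <= B) -> BmT_norm m T f <= B.
Proof.
move=> T0 fB; apply: ge_sup.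
  by exists (`|f 0 0| / weight m (0 : H)), (0, 0) => //; rewrite /strip /= lexx.
by move=> _ [[s x] sT <-]; exact: fB.
Qed.

Lemma BmT_section m T f s : BmT m T f -> 0 <= s <= T ->
  Bm m (f s) /\ Bm_norm m (f s) <= BmT_norm m T f.
Proof.
move=> /[dup] fB [mf _] sT.
have ub : ubound (range (fun x => `|f s x| / weight m x)) (BmT_norm m T f).
  by move=> _ [x _ <-]; exact: BmT_bound.
split; last by apply: ge_sup => //; exists (`|f s 0| / weight m (0 : H)), 0.
split; last by exists (BmT_norm m T f).
apply: (@measurable_comp _ _ _ (borel H) (borel (R * H)%type) _ (strip H T)
  (fun p => f p.1 p.2) setT (fun z => (s, z))) => //.
- exact: (@closed_borel _ (R * H)%type _ (@closed_strip R H T)).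
- by move=> _ [z _ <-].
- by apply: borel_map_of_open => G oG; exact: (open_borel _ (open_section s G oG)).
Qed.

Lemma BmT_sub m T f g : 0 <= T -> BmT m T f -> BmT m T g ->
  BmT m T (fun s x => f s x - g s x) /\
  BmT_norm m T (fun s x => f s x - g s x) <= BmT_norm m T f + BmT_norm m T g.
Proof.
move=> T0 fB gB.
have fgB s x : 0 <= s <= T ->
    `|f s x - g s x| / weight m x <= BmT_norm m T f + BmT_norm m T g.
  move=> sT; apply: le_trans (lerD (BmT_bound _ _ _ _ x fB sT)
    (BmT_bound _ _ _ _ x gB sT)).
  by rewrite -mulrDl ler_pM2r ?invr_gt0 ?weight_gt0 // ler_normB.
split; last exact: ler_BmT_norm.
split; first by apply: measurable_funB; [exact: fB.1|exact: gB.1].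
by exists (BmT_norm m T f + BmT_norm m T g) => _ [[s x] sT <-]; exact: fgB.
Qed.

Lemma BmT_penalty m T (eps : R) u Phi : 0 <= T -> 0 < eps ->
  BmT m T u -> BmT m T Phi -> BmT m T (penalty eps u Phi).
Proof.
move=> T0 e0 uB PhiB; have [dB _] := BmT_sub _ _ _ _ T0 uB PhiB.
split.
  apply: measurable_funM => //; apply: measurable_maxr => //; exact: dB.1.
exists (eps^-1 * BmT_norm m T (fun s x => u s x - Phi s x)) => _ [[s x] sT <-] /=.
rewrite /penalty normrM gtr0_norm ?invr_gt0 // -mulrA ler_pM2l ?invr_gt0 //.
apply: le_trans (BmT_bound _ _ _ _ x dB sT).
rewrite ler_pM2r ?invr_gt0 ?weight_gt0 //.
by case: (leP (u s x - Phi s x) 0) => [_|/gtr0_norm ->]; rewrite ?normr0 // gtr0_norm.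
Qed.

End WeightedNorms.

(** * Gradient estimates for the penalized equation *)

Theorem lemma5p5 (R : realType) (H Xi : hilbertType R)
  (sepH : separable H) (sepXi : separable Xi)
  (d : measure_display) (Omega : measurableType d) (P : probability Omega R)
  (F : R -> set (set Omega)) (hF : usual_filtration P F)
  (W : R -> Xi -> Omega -> R) (hW : cylindrical_wiener P F W)
  (T m : R) (hT : 0 < T) (hm : 1 <= m)
  (DomA : set H) (A : H -> H) (S : R -> H -> H)
  (linA : linear_operator DomA A) (closedA : closed_operator DomA A)
  (denseA : dense DomA) (genA : generates DomA A S)
  (b : R -> H -> H) (sigma : R -> H -> Xi -> H)
  (hcoef : lipschitz_coefficients T b sigma)
  (X : R -> H -> R -> Omega -> H)
  (hX : forall (t : R) (x : H), 0 <= t <= T ->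
    mild_state P F W T S b sigma t x (X t x))
  (C1 gamma : R) (hC1 : 0 < C1) (hgamma : 0 < gamma < 1)
  (hsmooth : smoothing m T (transition P X) C1 gamma)
  (f Phi : R -> H -> R) (Psi : H -> R)
  (hf : LipmT m T f) (hPhi : LipmT m T Phi) (hPsi : Lipm m Psi)
  (hPsiPhi : forall x : H, Psi x <= Phi T x)
  (eps : R) (heps : 0 < eps) (t : R) (ht : 0 <= t < T)
  (u : R -> H -> R)
  (hu : mild_penalized m T (transition P X) f Phi Psi eps u) :
  let N := BmT_norm m T f + BmT_norm m T (penalty eps u Phi) in
  (frechet_C1 (u t) /\
   forall x : H, `|grad (u t) x| <=
     C1 * (Bm_norm m Psi * (T - t) `^ (- gamma)
           + N * ((T - t) `^ (1 - gamma) / (1 - gamma))) * weight m x) /\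
  (forall r beta : R, 0 < r -> 0 < beta < 1 -> gamma * (1 + beta) < 1 ->
   let C3 := 2 `^ (1 - beta) * C1 in
   let Cr := C3 * (1 + r `^ m) in
   forall x y : H, `|x| <= r -> `|y| <= r ->
   `|grad (u t) x - grad (u t) y| <=
     Cr * (Bm_norm m Psi * (T - t) `^ (- (gamma * (1 + beta)))
           + N * ((T - t) `^ (1 - gamma * (1 + beta))
                  / (1 - gamma * (1 + beta)))) * `|x - y| `^ beta).
Proof.
move=> N; case/andP: ht => t0 tT; case/andP: (hgamma) => g0 g1.
have T0 : 0 <= T by exact: ltW.
have m0 : 0 <= m by exact: le_trans hm.
have fB := hf.1.1; have PhiB := hPhi.1.1; have PsiB := hPsi.1.1.
have PiB := BmT_penalty _ _ _ _ _ T0 heps hu.1 PhiB.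
pose g s y := f s y - penalty eps u Phi s y.
have [gB gN] := BmT_sub _ _ _ _ T0 fB PiB.
have sec s : t < s <= T -> Bm m (g s) /\ Bm_norm m (g s) <= N.
  move=> /andP[ts sT]; have s0T : 0 <= s <= T by rewrite (le_trans t0 (ltW ts)).
  by have [? sN] := BmT_section _ _ _ _ gB s0T; split => //; exact: le_trans gN.
have tT' : 0 <= t <= T by rewrite t0 ltW.
have mg x : measurable_fun `]t, T] (fun s => transition P X t s (g s) x).
  have [adX cX _] := hX t x tT'.
  apply: (@measurable_expectation _ _ _ _ P _ _ (X t x) (ltW tT)) => //;
    last exact: gB.1.
  move=> s sT _ B mB; rewrite setTI.
  have [FP _ _ _] := hF; have s0 : 0 <= s by case/andP: sT => ts _; exact: le_trans ts.
  by apply: (FP s s0).2; exact: adX.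
have [V1 Vb Vh] :=
  @duhamel_estimates _ _ _ _ _ _ _ m0 hC1 hgamma hsmooth _ _ _ t0 tT sec mg.
have [[PC1 _ _] Pest] := hsmooth t T Psi t0 tT (lexx T) PsiB.
set V := (fun x => \int[lebesgue_measure]_(s in `[t, T]) _) in V1 Vb Vh.
have uE : u t = transition P X t T Psi \+ V by apply/funext => x; exact: hu.2.
have gradE x : grad (u t) x = grad (transition P X t T Psi) x + grad V x.
  by rewrite uE gradD //; [exact: PC1.1|exact: V1.1].
split; first split.
- by rewrite uE; exact: frechet_C1D.
- move=> x; rewrite gradE; apply: (le_trans (ler_normD _ _)).
  apply: (le_trans (lerD (Pest x).1 (Vb x))).
  rewrite le_eqVlt; apply/orP; left; apply/eqP; ring.
- move=> r beta r0 b01 gb C3 Cr x y xr yr; rewrite !gradE opprD addrACA.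
  apply: (le_trans (ler_normD _ _)).
  have Ph := smoothing_holder _ _ _ _ _ _ _ _ _ _
    m0 (ltW hC1) hsmooth t0 tT (lexx T) PsiB b01 _ _ xr yr.
  apply: (le_trans (lerD Ph (Vh r beta b01 gb x y xr yr))).
  rewrite /Cr /C3 le_eqVlt; apply/orP; left; apply/eqP; ring.
Qed.
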